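(* Let $(\Xi,d)$, $c$, $\mathcal F$ satisfy the general assumptions (1)–(3) of the context, let $P$ be a probability distribution on $\Xi$, let $\epsilon>0$, $\tau\ge0$, and let $\pi_0(\cdot|\xi)$ be the reference kernel. Assume $\rho^{\tau,\epsilon}_{\mathrm{crit}}>4m_c$. Let $\lambda^{\tau,\epsilon}_{\mathrm{low}}>0$ be such that $\rho^{\tau,\epsilon}_{\max}(\lambda)\ge\frac{\rho^{\tau,\epsilon}_{\mathrm{crit}}}{4}$ for all $\lambda\in[0,2\lambda^{\tau,\epsilon}_{\mathrm{low}}]$. Let $\delta\in(0,1)$, $\rho>m_c$ and $$\alpha^{\tau,\epsilon}=48\Big(\|\mathcal F\|_\infty+\frac{1}{\lambda_{\mathrm{low}}^{\tau,\epsilon}}+\frac{2\|\mathcal F\|_\infty m_c\,\epsilon}{\epsilon(\rho-m_c)+2\tau\|\mathcal F\|_\infty}\Big)\Big(\mathcal I_{\mathcal F}+\frac{2}{\lambda_{\mathrm{low}}^{\tau,\epsilon}}\Big)+\Big(\frac{2\|\mathcal F\|_\infty}{\lambda_{\mathrm{low}}^{\tau,\epsilon}}+m_c\Big)\sqrt{2\log\frac2\delta}.$$ If $n>\frac{16(\alpha^{\tau,\epsilon})^2}{(\rho^{\tau,\epsilon}_{\mathrm{crit}}-4m_c)^2}$ and $m_c<\rho\le\frac{\rho^{\tau,\epsilon}_{\mathrm{crit}}}{4}-\frac{\alpha^{\tau,\epsilon}}{\sqrt n}$, then with probability at least $1-\delta$, $$\widehat R^{\tau,\epsilon}_\rho(f)\le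 R^{\tau,\epsilon}_{\rho+\frac{\alpha^{\tau,\epsilon}}{\sqrt n}}(f)\qquad\text{for all } f\in\mathcal F.$$
   Context: $(\Xi,d)$ is a metric space, $\mathcal F$ is a family of functions $f:\Xi\to\mathbb R$, $c:\Xi\times\Xi\to\mathbb R$ is a cost function. General assumptions: (1) $(\Xi,d)$ is compact. (2) $c$ is jointly continuous with respect to $d$, non-negative, and $c(\xi,\zeta)=0$ if and only if $\xi=\zeta$. (3) Every $f\in\mathcal F$ is continuous, $(\mathcal F,\|\cdot\|_\infty)$ is compact, and Dudley's entropy $\mathcal I_{\mathcal F}:=\int_0^\infty\sqrt{\log N(t,\mathcal F,\|\cdot\|_\infty)}\,dt$ is finite, where $N(t,\mathcal F,\|\cdot\|_\infty)$ is the $t$-packing number of $\mathcal F$ (maximal number of functions in $\mathcal F$ that are pairwise at distance at least $t$). $\|\mathcal F\|_\infty=\sup_{f\in\mathcal F}\sup_\Xi|f|$. $\mathcal P(\cdot)$ denotes Borel probability measures, $[\pi]_1,[\pi]_2$ the marginals of $\pi\in\mathcal P(\Xi\times\Xi)$. A Markov kernel $\xi\mapsto\pi_0(\cdot|\xi)\in\mathcal P(\Xi)$ is fixed; whenever couplings with first marginal $Q$ are considered, the reference coupling is $\pi_0(d\xi,d\zeta)=Q(d\xi)\,\pi_0(d\zeta|\xi)$. $D_{\mathrm{KL}}(\pi\|\pi_0)=\int\log\frac{d\pi}{d\pi_0}d\pi$ if $\pi\ll\pi_0$ and $+\infty$ otherwise (with $0\cdot\infty=0$). Regularized robust risk: $$R^{\tau,\epsilon}_{\rho,Q}(f)=\sup\{\mathbb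 E_{[\pi]_2}[f]-\epsilon D_{\mathrm{KL}}(\pi\|\pi_0):\pi\in\mathcal P(\Xi\times\Xi),\ [\pi]_1=Q,\ \mathbb E_\pi[c]+\tau D_{\mathrm{KL}}(\pi\|\pi_0)\le\rho\}.$$ With $\xi_1,\dots,\xi_n$ i.i.d. from $P$ and $\widehat P_n=\frac1n\sum_i\delta_{\xi_i}$: $\widehat R^{\tau,\epsilon}_\rho=R^{\tau,\epsilon}_{\rho,\widehat P_n}$, $R^{\tau,\epsilon}_\rho=R^{\tau,\epsilon}_{\rho,P}$. Conditional moment: $m_c=\max_{\xi\in\Xi}\mathbb E_{\zeta\sim\pi_0(\cdot|\xi)}[c(\xi,\zeta)]$ (understood as a supremum). Regularized critical radius: $$\rho^{\tau,\epsilon}_{\mathrm{crit}}=\inf_{f\in\mathcal F}\mathbb E_{\xi\sim P}\Big[\mathbb E_{\zeta\sim\pi_0^{f/\epsilon}(\cdot|\xi)}\big[\tfrac\tau\epsilon f(\zeta)+c(\xi,\zeta)\big]-\tau\log\mathbb E_{\zeta\sim\pi_0(\cdot|\xi)}\big[e^{f(\zeta)/\epsilon}\big]\Big],$$ where $d\pi_0^{f/\epsilon}(\cdot|\xi)\propto e^{f/\epsilon}d\pi_0(\cdot|\xi)$. Regularized dual generator: $\phi^{\tau,\epsilon}(\lambda,f,\xi)=(\epsilon+\lambda\tau)\log\mathbb E_{\zeta\sim\pi_0(\cdot|\xi)}\big[e^{\frac{f(\zeta)-\lambda c(\xi,\zeta)}{\epsilon+\lambda\tau}}\big]$, $\lambda\ge0$.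 Regularized maximal radius: $\rho^{\tau,\epsilon}_{\max}(\lambda)=\inf_{f\in\mathcal F}\mathbb E_{\xi\sim P}[-\partial_\lambda\phi^{\tau,\epsilon}(\lambda,f,\xi)]$. A constant $\lambda^{\tau,\epsilon}_{\mathrm{low}}$ as required in the claim exists. *)

(* Defs.v *)
From HB Require Import structures.
From mathcomp Require Import all_boot all_order all_algebra.
From mathcomp Require Import all_classical all_reals all_analysis.
From mathcomp Require Import measurable_realfun.

Set Implicit Arguments.
Unset Strict Implicit.
Unset Printing Implicit Defensive.

Import Order.TTheory GRing.Theory Num.Theory.
Import numFieldNormedType.Exports.

Local Open Scope classical_set_scope.
Local Open Scope ring_scope.

(* The library's generated sigma-algebras live on pointed types; a type that
   carries a probability measure is nonempty anyway. *)
#[short(type="pmetricType")]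
HB.structure Definition PointedMetric (K : numDomainType) :=
  { M of Metric K M & isPointed M }.

(* On a compact (hence second countable) metric space X, the product
   sigma-algebra on borel X * borel X is the Borel sigma-algebra of X * X. *)
Notation borel X := (g_sigma_algebraType (@open X)).

Section ref_coupling.
Local Open Scope ereal_scope.
Context d1 d2 (X : measurableType d1) (Y : measurableType d2) (R : realType).
Variables (Q : {finite_measure set X -> \bar R}) (k : R.-pker X ~> Y).

(* Q(dx) k(dy | x) *)
Definition ref_coupling (A : set (X * Y)) : \bar R :=
  \int[Q]_x k x (xsection A x).

Let mref A : measurable A ->
  measurable_fun [set: X] (fun x => k x (xsection A x)).
Proof. by move=> mA; apply: measurable_fun_xsection_finite_kernel; rewrite inE. Qed.

Let ref0 : ref_coupling set0 = 0.
Proof. by apply: integral0_eq => x _; rewrite xsection0 measure0. Qed.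

Let ref_ge0 A : 0 <= ref_coupling A.
Proof. exact: integral_ge0. Qed.

Let ref_sigma_additive : semi_sigma_additive ref_coupling.
Proof.
move=> F mF tF mUF; have -> : ref_coupling (\bigcup_n F n) =
    \sum_(0 <= n <oo) ref_coupling (F n).
  rewrite /ref_coupling -integral_nneseries//; last by move=> n; exact: mref.
  apply: eq_integral => x _; apply/esym/cvg_lim => //=; rewrite xsection_bigcup.
  apply: (measure_sigma_additive _ (trivIset_xsection tF)) => n.
  exact: measurable_xsection.
exact: is_cvg_nneseries.
Qed.

HB.instance Definition _ := isMeasure.Build _ _ _ ref_coupling
  ref0 ref_ge0 ref_sigma_additive.

Let ref_fin : fin_num_fun ref_coupling.
Proof.
apply: lty_fin_num_fun; rewrite /= /ref_coupling.
rewrite (@eq_integral _ _ _ _ _ (cst 1)) => [|x _]; last first.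
  by rewrite xsectionE preimage_setT prob_kernel.
by rewrite integral_cst// mul1e -ge0_fin_numE// fin_num_measure.
Qed.

HB.instance Definition _ := Measure_isFinite.Build _ _ _ ref_coupling ref_fin.

End ref_coupling.

Section empirical.
Local Open Scope ereal_scope.
Context d (T : measurableType d) (R : realType) (n : nat) (x : 'I_n -> T).

Definition empirical (A : set T) : \bar R :=
  (n%:R^-1)%:E * \sum_(i < n) \d_(x i) A.

Let empirical0 : empirical set0 = 0.
Proof. by rewrite /empirical big1 ?mule0// => i _; rewrite measure0. Qed.

Let empirical_ge0 A : 0 <= empirical A.
Proof. by rewrite mule_ge0 ?lee_fin ?invr_ge0// sume_ge0. Qed.

Let empirical_sigma_additive : semi_sigma_additive empirical.
Proof.
move=> F mF tF mUF; rewrite [X in X @ \oo --> _](_ : _ =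
    (fun m => (n%:R^-1)%:E * \sum_(i < n) \sum_(0 <= k < m) \d_(x i) (F k))).
  apply: cvgeZl => //; apply: cvg_nnesum => [i _|i _].
    by apply: nearW => m; exact: sume_ge0.
  exact: measure_semi_sigma_additive.
apply/funext => m; rewrite -ge0_sume_distrr => [|i _]; last exact: sume_ge0.
by rewrite exchange_big.
Qed.

HB.instance Definition _ := isMeasure.Build _ _ _ empirical
  empirical0 empirical_ge0 empirical_sigma_additive.

Let empirical_fin : fin_num_fun empirical.
Proof.
move=> A mA; rewrite fin_numM//; apply/sum_fin_numP => i _ _.
exact: fin_num_measure.
Qed.

HB.instance Definition _ := Measure_isFinite.Build _ _ _ empirical empirical_fin.

End empirical.
Arguments empirical {d T} R {n} x.

Section divergence.
Local Open Scope ereal_scope.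
Context d (T : measurableType d) (R : realType).

Definition KL (pi : probability T R) (mu : {finite_measure set T -> \bar R}) :
    \bar R :=
  if `[< pi `<< mu >] then
    \int[pi]_z lne (Radon_Nikodym (charge_of_finite_measure pi) mu z)
  else +oo.

(* The probability measure proportional to [expR g] times [mu]. *)
Definition tilted (mu : {measure set T -> \bar R}) (g : T -> R) (A : set T) :
    \bar R :=
  \int[mu]_(z in A) (expR (g z) / fine (\int[mu]_y (expR (g y))%:E))%:E.

End divergence.

Section sample.
Context d d' (Omega : measurableType d) (T : measurableType d') (R : realType).
Variables (Pr : probability Omega R) (n : nat) (xi : 'I_n -> {RV Pr >-> T}).
Local Open Scope ereal_scope.

(* Taking some of the [B i] equal to [setT] gives the product rule for
   subfamilies. *)
Definition independent_RVs := forall B : 'I_n -> set T,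
  (forall i, measurable (B i)) ->
  Pr (\bigcap_(i in [set: 'I_n]) (xi i @^-1` B i)) =
  \prod_(i < n) Pr (xi i @^-1` B i).

Definition iid_from (P : probability T R) :=
  independent_RVs /\
  forall i A, measurable A -> distribution Pr (xi i) A = P A.

End sample.

Section function_class.
Context {R : realType} {X : pmetricType R}.
Implicit Types (f : X -> R) (F : set (X -> R)).

(* The suprema below are taken in R; in their intended use the functions are
   continuous on a compact space and F is compact, so they are finite. *)
Definition supnorm f : R := sup [set `|f x| | x in [set: X]].

Definition class_norm F : R := sup [set supnorm f | f in F].

Definition packing_number F (t : R) : \bar R :=
  ereal_sup [set n%:R%:E | n in
    [set n : nat | exists g : 'I_n -> X -> R, (forall i, F (g i)) /\
      forall i j, i != j -> t <= supnorm (fun x => g i x - g j x)]].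

Definition dudley_entropy F : \bar R :=
  (\int[@lebesgue_measure R]_(t in `]0%R, +oo[) sqrte (lne (packing_number F t)))%E.

End function_class.

Section robust_risk.
Context {R : realType} {X : pmetricType R}.
Variables (c : X * X -> R) (pi0 : R.-pker borel X ~> borel X).
Variables (eps tau : R).
Implicit Types (f : X -> R) (P : probability (borel X) R).

Section risk.
Local Open Scope ereal_scope.
Variables (rho : R) (Q : {finite_measure set (borel X) -> \bar R}).

Definition ambiguity_set : set (probability (borel X * borel X)%type R) :=
  [set pi : probability (borel X * borel X)%type R |
            (forall A, measurable A ->
               pushforward pi (@fst (borel X) (borel X)) A = Q A) /\
            \int[pi]_z (c z)%:E + tau%:E * KL pi (ref_coupling Q pi0)
              <= rho%:E].

Definition robust_risk f : \bar R :=
  ereal_sup [set \int[pushforward pi (@snd (borel X) (borel X))]_z (f z)%:E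
                 - eps%:E * KL pi (ref_coupling Q pi0) | pi in ambiguity_set].

End risk.

Definition cond_moment : R :=
  sup [set \int[pi0 x]_z c (x, z) | x in [set: X]].

Definition crit_radius P (F : set (X -> R)) : R :=
  inf [set \int[P]_x
             (fine (\int[tilted (pi0 x) (fun z => (f z / eps)%R)]_z
                      (tau / eps * f z + c (x, z))%R%:E)%E
              - tau * ln (\int[pi0 x]_z expR (f z / eps))) | f in F].

Definition dual_generator (lambda : R) f (x : X) : R :=
  (eps + lambda * tau) *
  ln (\int[pi0 x]_z expR ((f z - lambda * c (x, z)) / (eps + lambda * tau))).

(* When [0 < eps] and [0 <= tau] the dual generator is defined by the same
   formula on a neighbourhood of [lambda = 0], where its one-sided and
   two-sided derivatives agree. *)
Definition max_radius P (F : set (X -> R)) (lambda : R) : R :=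
  inf [set \int[P]_x (- derive1 (fun l => dual_generator l f x) lambda) | f in F].

Definition alpha (F : set (X -> R)) (lambda_low rho delta : R) : R :=
  let M := class_norm F in
  let m := cond_moment in
  48 * (M + lambda_low^-1
          + 2 * M * m * eps / (eps * (rho - m) + 2 * tau * M))
     * (fine (dudley_entropy F) + 2 / lambda_low)
  + (2 * M / lambda_low + m) * Num.sqrt (2 * ln (2 / delta)).

End robust_risk.

(* Main.v *)
Require Import Defs.
From HB Require Import structures.
From mathcomp Require Import all_boot all_order all_algebra finmap.
From mathcomp Require Import all_classical all_reals all_analysis.
From mathcomp Require Import measurable_realfun.
From mathcomp Require Import ring lra.

(* Write phi_lam(f, x) for the dual generator. The variational formula of
   Donsker and Varadhan gives R_rho,Q(f) <= lam rho + E_Q[phi_lam(f)] for all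
   lam >= 0 and all Q, with equality when Q = P and lam satisfies the first-order
   condition E_P[- d/dlam phi_lam(f)] = rho: the optimal coupling is then the
   reference coupling tilted by (f - lam c) / (eps + lam tau). At the radius
   rho' = rho + alpha / sqrt n, the assumption on the maximal radius and rho' > m_c
   place a solution lam of this condition in
   [2 lam_low, 2 |F| / (rho' - m_c)]. It remains to bound, uniformly in f and in
   such lam, the empirical process of phi_lam(f) / lam by alpha / sqrt n. In terms
   of theta = 1 / lam this function is Lipschitz in (theta, f) for the norms
   |theta| and |f|_oo, with constants 1 / lam_low and the first factor of alpha,
   and chaining with Hoeffding's inequality over dyadic nets of F and of the range
   of theta applies. The chain starts from the net whose scale is proportional to
   the range of phi_lam(f) / lam, so that the dependence on delta is carried by
   the base of the chain, whatever the Lipschitz constants are. *)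

Set Implicit Arguments.
Unset Strict Implicit.
Unset Printing Implicit Defensive.

Import Order.TTheory GRing.Theory Num.Theory.
Import numFieldNormedType.Exports.

Local Open Scope classical_set_scope.
Local Open Scope ring_scope.

(** * Bounded measurable functions *)

Section bounded_measurable.
Context d (T : measurableType d) (R : realType).
Implicit Types f g : T -> R.

(** The empirical side needs weak duality only, so the multiplier lam is chosen from f and P alone
    and serves both measures. After division by lam the claim becomes a single inequality: the
    centered empirical mean of phi_lam(f) / lam is at most rho' - rho. Hence a one-sided tail bound
    is enough.

    The range of theta must not depend on rho', which is defined through alpha. It starts at (rho -
    m_c) / (2 |F|), at or below the value that rho' would give; at this endpoint m_c eps / (eps
    theta + tau) is the third term of the first factor of alpha. That term comes from bounding the
    divergence of a tilted law by the conditional mean of c; the uniform bound of c enters no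
    constant of alpha. Since phi_lam(f) / lam lies between - theta |F| - m_c and theta |F|, its
    range has length at most 2 |F| / lam_low + m_c, the factor of the square root in alpha.

    In 48 = 24 * 2 the 24 generously bounds the chaining constant 6 sqrt 2, and the 2 is the cost of
    comparing dyadic sums with Dudley's integral. The range of theta adds 4 / lam_low to these sums,
    hence 2 / lam_low in alpha. *)

Definition bmeas f :=
  measurable_fun [set: T] f /\ exists M, forall x, `|f x| <= M.

Lemma bmeas_meas f : bmeas f -> measurable_fun [set: T] f.
Proof. by case. Qed.

Lemma bmeas_cst (r : R) : bmeas (cst r).
Proof. by split=> //; exists `|r|. Qed.

Lemma bmeasD f g : bmeas f -> bmeas g -> bmeas (fun x => f x + g x).
Proof.
move=> [mf [M hM]] [mg [N hN]]; split; first exact: measurable_funD.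
by exists (M + N) => x; rewrite (le_trans (ler_normD _ _))// lerD.
Qed.

Lemma bmeasM f g : bmeas f -> bmeas g -> bmeas (fun x => f x * g x).
Proof.
move=> [mf [M hM]] [mg [N hN]]; split; first exact: measurable_funM.
by exists (M * N) => x; rewrite normrM ler_pM.
Qed.

Lemma bmeasZ (r : R) f : bmeas f -> bmeas (fun x => r * f x).
Proof. by move=> bf; apply: bmeasM => //; exact: bmeas_cst. Qed.

Lemma bmeasZr (r : R) f : bmeas f -> bmeas (fun x => f x * r).
Proof. by move=> bf; apply: bmeasM => //; exact: bmeas_cst. Qed.

Lemma bmeasN f : bmeas f -> bmeas (fun x => - f x).
Proof.
by move=> [mf [M hM]]; split; [exact: measurableT_comp|exists M => x; rewrite normrN].
Qed.

Lemma bmeasB f g : bmeas f -> bmeas g -> bmeas (fun x => f x - g x).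
Proof. by move=> bf bg; apply: bmeasD => //; exact: bmeasN. Qed.

Lemma bmeas_expR f : bmeas f -> bmeas (fun x => expR (f x)).
Proof.
move=> [mf [M hM]]; split; first exact: measurableT_comp.
exists (expR M) => x; rewrite ger0_norm ?expR_ge0// ler_expR.
exact: le_trans (ler_norm _) (hM x).
Qed.

Lemma bmeas_comp d' (T' : measurableType d') (h : T -> T') (f : T' -> R) :
  measurable_fun [set: T] h -> measurable_fun [set: T'] f ->
  (exists M, forall x, `|f x| <= M) -> bmeas (fun x => f (h x)).
Proof.
by move=> mh mf [M hM]; split; [exact: measurableT_comp|exists M => x].
Qed.

Lemma bmeas_sum (I : Type) (r : seq I) (F : I -> T -> R) : (forall i, bmeas (F i)) ->
  bmeas (fun x => \sum_(i <- r) F i x).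
Proof.
move=> bF; elim: r => [|i r ih].
  rewrite (_ : (fun _ => _) = cst 0); first exact: bmeas_cst.
  by apply/funext => x; rewrite big_nil.
rewrite (_ : (fun _ => _) = fun x => F i x + \sum_(i <- r) F i x); first exact: bmeasD.
by apply/funext => x; rewrite big_cons.
Qed.

Lemma bmeas_prod (I : Type) (r : seq I) (F : I -> T -> R) : (forall i, bmeas (F i)) ->
  bmeas (fun x => \prod_(i <- r) F i x).
Proof.
move=> bF; elim: r => [|i r ih].
  rewrite (_ : (fun _ => _) = cst 1); first exact: bmeas_cst.
  by apply/funext => x; rewrite big_nil.
rewrite (_ : (fun _ => _) = fun x => F i x * \prod_(i <- r) F i x); first exact: bmeasM.
by apply/funext => x; rewrite big_cons.
Qed.

Lemma bmeas_integrable (mu : {finite_measure set T -> \bar R}) f :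
  bmeas f -> mu.-integrable [set: T] (EFin \o f).
Proof.
move=> [mf [M hM]]; apply: measurable_bounded_integrable => //.
  by rewrite -ge0_fin_numE//; exact: fin_num_measure.
rewrite /bounded_near; near=> N => x _ /=; rewrite (le_trans (hM x))//.
Unshelve. all: by end_near. Qed.

End bounded_measurable.

Arguments bmeas_cst {d T R} r.

Ltac bmeas := solve [repeat first
  [ assumption | exact: bmeas_cst | apply: bmeas_expR | apply: bmeasB
  | apply: bmeasN | apply: bmeasD | apply: bmeasZ | apply: bmeasZr | apply: bmeasM ]].

Section expectation.
Context d (T : measurableType d) (R : realType) (mu : {finite_measure set T -> \bar R}).
Implicit Types f g : T -> R.

Lemma EFin_Rintegral f : bmeas f -> ((\int[mu]_x f x)%:E = \int[mu]_x (f x)%:E)%E.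
Proof.
by move=> bf; rewrite fineK//; apply: integrable_fin_num => //; exact: bmeas_integrable.
Qed.

Lemma bRintegralD f g : bmeas f -> bmeas g ->
  \int[mu]_x (f x + g x) = \int[mu]_x f x + \int[mu]_x g x.
Proof. by move=> bf bg; apply: RintegralD => //; exact: bmeas_integrable. Qed.

Lemma bRintegralB f g : bmeas f -> bmeas g ->
  \int[mu]_x (f x - g x) = \int[mu]_x f x - \int[mu]_x g x.
Proof. by move=> bf bg; apply: RintegralB => //; exact: bmeas_integrable. Qed.

Lemma bRintegralZl (r : R) f : bmeas f -> \int[mu]_x (r * f x) = r * \int[mu]_x f x.
Proof. by move=> bf; apply: RintegralZl => //; exact: bmeas_integrable. Qed.

Lemma bRintegralZr (r : R) f : bmeas f -> \int[mu]_x (f x * r) = \int[mu]_x f x * r.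
Proof. by move=> bf; apply: RintegralZr => //; exact: bmeas_integrable. Qed.

Lemma le_bRintegral f g : bmeas f -> bmeas g -> (forall x, f x <= g x) ->
  \int[mu]_x f x <= \int[mu]_x g x.
Proof. by move=> bf bg fg; apply: le_Rintegral => //; exact: bmeas_integrable. Qed.

Lemma bRintegral_sum (I : Type) (r : seq I) (F : I -> T -> R) : (forall i, bmeas (F i)) ->
  \int[mu]_x (\sum_(i <- r) F i x) = \sum_(i <- r) \int[mu]_x F i x.
Proof.
move=> bF; elim: r => [|i r ih].
  rewrite big_nil -[RHS](mul0r (fine (mu setT))) -Rintegral_cst//.
  by apply: eq_Rintegral => x _; rewrite big_nil.
rewrite big_cons -ih -bRintegralD//; last exact: bmeas_sum.
by apply: eq_Rintegral => x _; rewrite big_cons.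
Qed.

End expectation.

Section probability_expectation.
Context d (T : measurableType d) (R : realType) (mu : probability T R).
Implicit Types f g : T -> R.

Lemma Rintegral_prob_cst (r : R) : \int[mu]_x r = r.
Proof.
rewrite Rintegral_cst// (_ : fine _ = 1) ?mulr1//.
by have /= -> := probability_setT mu.
Qed.

Lemma bRintegral_le_cst f (r : R) : bmeas f -> (forall x, f x <= r) ->
  \int[mu]_x f x <= r.
Proof.
by move=> bf fr; rewrite -[leRHS]Rintegral_prob_cst; apply: le_bRintegral => //; exact: bmeas_cst.
Qed.

Lemma bRintegral_ge_cst f (r : R) : bmeas f -> (forall x, r <= f x) ->
  r <= \int[mu]_x f x.
Proof.
by move=> bf fr; rewrite -[leLHS]Rintegral_prob_cst; apply: le_bRintegral => //; exact: bmeas_cst.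
Qed.

Lemma bRintegral_norm_le f (r : R) : bmeas f -> (forall x, `|f x| <= r) ->
  `|\int[mu]_x f x| <= r.
Proof.
move=> bf fr; rewrite ler_norml bRintegral_le_cst// ?bRintegral_ge_cst//.
- by move=> x; have := fr x; rewrite ler_norml => /andP[].
- by move=> x; have := fr x; rewrite ler_norml => /andP[].
Qed.

End probability_expectation.

(** * Exponential tilting *)

Lemma ln_le_subr1 (R : realType) (y : R) : 0 < y -> ln y <= y - 1.
Proof.
by move=> y0; have := @le_ln1Dx _ (y - 1); rewrite [1 + _]addrC subrK; apply; lra.
Qed.

(* Compare [expR x = expR (- x / 2) ^- 2] with [(1 - x / 2) ^- 2]. *)
Lemma expR_le1DxDsqr (R : realType) (x : R) : `|x| <= 1/3 -> expR x <= 1 + x + x ^+ 2.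
Proof.
rewrite ler_norml => /andP[xl xr].
have e2 : expR x = (expR (- (x / 2)))^-1 ^+ 2.
  by rewrite -expRN opprK -expRM_natl; congr expR; lra.
have h1 : 1 - x / 2 <= expR (- (x / 2)) by exact: expR_ge1Dx.
have h1p : 0 < 1 - x / 2 by lra.
have p0 : 0 < 1 + x + x ^+ 2 by nra.
rewrite e2 exprVn -[leRHS]invrK lef_pV2 ?posrE ?invr_gt0//; last first.
  by rewrite exprn_gt0// expR_gt0.
apply: (@le_trans _ _ ((1 - x / 2) ^+ 2)).
  rewrite -div1r ler_pdivrMr//.
  rewrite !expr2; have : 0 <= x * x * (1 - 3 * x + x * x) by apply: mulr_ge0; nra.
  lra.
by rewrite !expr2 ler_pM // ltW.
Qed.

Section tilting.
Context d (T : measurableType d) (R : realType) (mu : probability T R).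
Implicit Types u v w : T -> R.

Definition partition_fun u : R := \int[mu]_x expR (u x).
Definition log_partition u : R := ln (partition_fun u).
(* expectation under the probability proportional to [expR u] times [mu] *)
Definition tilt u w : R := (\int[mu]_x (w x * expR (u x))) / partition_fun u.
(* divergence of that probability from [mu] *)
Definition tiltKL u : R := tilt u u - log_partition u.

Local Notation Z := partition_fun.
Local Notation J := log_partition.

Lemma partition_fun_gt0 u : bmeas u -> 0 < Z u.
Proof.
move=> bu; have [_ [M hM]] := bu.
apply: lt_le_trans (expR_gt0 (- M)) _; apply: bRintegral_ge_cst; first exact: bmeas_expR.
by move=> x; rewrite ler_expR lerNl (le_trans (ler_norm _))// normrN.
Qed.

Lemma expR_log_partition u : bmeas u -> expR (J u) = Z u.
Proof. by move=> bu; rewrite lnK// posrE partition_fun_gt0. Qed.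

Lemma tiltD u v w : bmeas u -> bmeas v -> bmeas w ->
  tilt u (fun x => v x + w x) = tilt u v + tilt u w.
Proof.
move=> bu bv bw; rewrite /tilt -mulrDl -bRintegralD; try bmeas.
by congr (_ / _); apply: eq_Rintegral => x _; rewrite mulrDl.
Qed.

Lemma tiltZ u (r : R) w : bmeas u -> bmeas w ->
  tilt u (fun x => r * w x) = r * tilt u w.
Proof.
move=> bu bw; rewrite /tilt mulrA -bRintegralZl; try bmeas.
by congr (_ / _); apply: eq_Rintegral => x _; rewrite mulrA.
Qed.

Lemma tiltB u v w : bmeas u -> bmeas v -> bmeas w ->
  tilt u (fun x => v x - w x) = tilt u v - tilt u w.
Proof.
move=> bu bv bw; rewrite -mulN1r -tiltZ// -tiltD//; last exact: bmeasZ.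
by congr tilt; apply/funext => x; rewrite mulN1r.
Qed.

Lemma tilt_cst u (r : R) : bmeas u -> tilt u (cst r) = r.
Proof.
move=> bu; rewrite /tilt /= bRintegralZl; last exact: bmeas_expR.
by rewrite -/(Z u) mulfK// gt_eqF// partition_fun_gt0.
Qed.

Lemma le_tilt u v w : bmeas u -> bmeas v -> bmeas w -> (forall x, v x <= w x) ->
  tilt u v <= tilt u w.
Proof.
move=> bu bv bw vw; rewrite /tilt ler_pM2r ?invr_gt0 ?partition_fun_gt0//.
apply: le_bRintegral => [| |x]; try bmeas.
by rewrite ler_pM2r ?expR_gt0.
Qed.

Lemma tilt_norm_le u w (r : R) : bmeas u -> bmeas w -> (forall x, `|w x| <= r) ->
  `|tilt u w| <= r.
Proof.
move=> bu bw wr; rewrite ler_norml -[X in X <= _ <= _](tilt_cst (- r) bu) -[X in _ <= _ <= X](tilt_cst r bu).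
by rewrite !le_tilt//; try exact: bmeas_cst; move=> x /=; have := wr x; rewrite ler_norml => /andP[].
Qed.

Lemma tilt_ge0 u w : bmeas u -> bmeas w -> (forall x, 0 <= w x) -> 0 <= tilt u w.
Proof. by move=> bu bw w0; rewrite -[leLHS](tilt_cst 0 bu) le_tilt//; exact: bmeas_cst. Qed.

Lemma tilt0 w : tilt (cst 0) w = \int[mu]_x w x.
Proof.
rewrite /tilt (_ : Z (cst 0) = 1) ?divr1; last first.
  by rewrite -[RHS](Rintegral_prob_cst mu); apply: eq_Rintegral => x _; rewrite expR0.
apply: eq_Rintegral => x _.
by rewrite /= expR0 mulr1.
Qed.

Lemma log_partition0 : J (cst 0) = 0.
Proof.
rewrite /J (_ : Z (cst 0) = 1) ?ln1//.
by rewrite -[RHS](Rintegral_prob_cst mu); apply: eq_Rintegral => x _; rewrite expR0.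
Qed.

Lemma partition_fun_tilt u v : bmeas u -> bmeas v ->
  Z v = Z u * tilt u (fun x => expR (v x - u x)).
Proof.
move=> bu bv; rewrite /tilt mulrC divfK ?gt_eqF ?partition_fun_gt0//.
by apply: eq_Rintegral => x _; rewrite -expRD subrK.
Qed.

(* Jensen's inequality for the tilted measure, that is, convexity of [J]. *)
Lemma log_partition_subgradient u v : bmeas u -> bmeas v ->
  J u + tilt u (fun x => v x - u x) <= J v.
Proof.
move=> bu bv; set a := tilt u _.
have buv : bmeas (fun x => v x - u x) by exact: bmeasB.
rewrite -ler_expR expRD !expR_log_partition// (partition_fun_tilt bu bv).
rewrite ler_pM2l ?partition_fun_gt0//.
have -> : expR a = tilt u (fun x => expR a * (1 + (v x - u x - a))).
  rewrite tiltZ; try bmeas; rewrite tiltD; try bmeas; rewrite tiltB; try bmeas.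
  by rewrite !tilt_cst// -/a subrr addr0 mulr1.
apply: le_tilt; try bmeas.
move=> x; have := expR_ge1Dx (v x - u x - a).
by rewrite -(ler_pM2l (expR_gt0 a)) -expRD [a + _]addrC subrK.
Qed.

(** [ln y <= y - 1] and the quadratic bound on [expR], both under the tilted measure. Together with
    the subgradient bound it determines derivatives of [J] without differentiating under the
    integral sign. *)
Lemma log_partition_smooth u v (r : R) : bmeas u -> bmeas v ->
  (forall x, `|v x - u x| <= r) -> r <= 1/3 ->
  J v <= J u + tilt u (fun x => v x - u x) + r ^+ 2.
Proof.
move=> bu bv uvr r3; set a := tilt u _.
have buv : bmeas (fun x => v x - u x) by exact: bmeasB.
have tp : 0 < tilt u (fun x => expR (v x - u x)).
  by rewrite -(pmulr_rgt0 _ (partition_fun_gt0 bu)) -partition_fun_tilt// partition_fun_gt0.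
rewrite /J (partition_fun_tilt bu bv) lnM ?posrE ?partition_fun_gt0// -addrA lerD2l.
rewrite (le_trans (ln_le_subr1 tp))// lerBlDl addrA.
have -> : 1 + a + r ^+ 2 = tilt u (fun x => 1 + (v x - u x) + r ^+ 2).
  by rewrite tiltD; try bmeas; rewrite tiltD; try bmeas; rewrite !tilt_cst.
apply: le_tilt; try bmeas.
move=> x; rewrite (le_trans (expR_le1DxDsqr _)) ?(le_trans (uvr x))//.
by rewrite lerD2l -[leLHS]real_normK ?num_real// lerXn2r ?nnegrE// (le_trans _ (uvr x)).
Qed.

Lemma tiltKL_ge0 u : bmeas u -> 0 <= tiltKL u.
Proof.
move=> bu; have := log_partition_subgradient bu (bmeas_cst (0 : R)).
rewrite log_partition0 tiltB ?tilt_cst//; try bmeas.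
by rewrite /tiltKL; lra.
Qed.

Lemma log_partition_ge_Rintegral u : bmeas u -> \int[mu]_x u x <= J u.
Proof.
move=> bu; have := log_partition_subgradient (bmeas_cst (0 : R)) bu.
by rewrite log_partition0 tiltB ?tilt_cst ?tilt0 /=; [lra|bmeas..].
Qed.

Lemma log_partition_le u (r : R) : bmeas u -> (forall x, u x <= r) -> J u <= r.
Proof.
move=> bu ur; rewrite -ler_expR expR_log_partition//.
by apply: bRintegral_le_cst; [exact: bmeas_expR|move=> x; rewrite ler_expR].
Qed.

(* The perspective [s * J (w / s)] is jointly convex in [(s, w)]. *)
Definition perspective (s : R) w : R := s * J (fun x => w x / s).

Let perspective_tilt (s s' : R) w w' : 0 < s -> 0 < s' -> bmeas w -> bmeas w' ->
  s' * tilt (fun x => w x / s) (fun x => w' x / s' - w x / s) =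
  tilt (fun x => w x / s) (fun x => w' x - w x) -
  (s' - s) * tilt (fun x => w x / s) (fun x => w x / s).
Proof.
move=> s0 s'0 bw bw'; have bu : bmeas (fun x => w x / s) by exact: bmeasZr.
rewrite -!tiltZ -?tiltB; try bmeas.
by congr tilt; apply/funext => x; field; rewrite !gt_eqF.
Qed.

(** The subgradient inequality for [J] at [w / s], multiplied by [s']. The slope in the direction of
    [s] is [J - tilt u u] at [u = w / s], that is, minus [tiltKL]. *)
Lemma perspective_subgradient (s s' : R) w w' : 0 < s -> 0 < s' ->
  bmeas w -> bmeas w' ->
  perspective s w + tilt (fun x => w x / s) (fun x => w' x - w x)
    - (s' - s) * tiltKL (fun x => w x / s) <= perspective s' w'.
Proof.
move=> s0 s'0 bw bw'; have key := perspective_tilt s0 s'0 bw bw'.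
have := log_partition_subgradient (bmeasZr s^-1 bw) (bmeasZr s'^-1 bw').
by rewrite -(ler_pM2l s'0) [leLHS]mulrDr key /perspective /tiltKL; lra.
Qed.

Lemma perspective_smooth (s s' r : R) w w' : 0 < s -> 0 < s' ->
  bmeas w -> bmeas w' -> (forall x, `|w' x / s' - w x / s| <= r) -> r <= 1/3 ->
  perspective s' w' <= perspective s w + tilt (fun x => w x / s) (fun x => w' x - w x)
    - (s' - s) * tiltKL (fun x => w x / s) + s' * r ^+ 2.
Proof.
move=> s0 s'0 bw bw' rw r3; have key := perspective_tilt s0 s'0 bw bw'.
have := log_partition_smooth (bmeasZr s^-1 bw) (bmeasZr s'^-1 bw') rw r3.
by rewrite -(ler_pM2l s'0) [leRHS]mulrDr [X in _ <= X + _]mulrDr key /perspective /tiltKL; lra.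
Qed.

End tilting.

(** * Disintegration of the reference coupling *)

Section kernel_expectation.
Import HBNNSimple.
Context d1 d2 (X : measurableType d1) (Y : measurableType d2) (R : realType).
Variable k : R.-pker X ~> Y.

(* The kernel structure only provides measures; here the total mass is recorded. *)
Definition kernel_prob (x : X) : set Y -> \bar R := k x.
HB.instance Definition _ x := Measure.on (kernel_prob x).
HB.instance Definition _ x :=
  Measure_isProbability.Build _ _ _ (kernel_prob x) (prob_kernel x).

Lemma bmeas_pair (h : X * Y -> R) (x : X) : bmeas h -> bmeas (fun y => h (x, y)).
Proof.
by move=> [mh bh]; apply: bmeas_comp => //; exact: measurable_pair1.
Qed.

Lemma bmeas_kernel_Rintegral (h : X * Y -> R) : bmeas h ->
  bmeas (fun x => \int[kernel_prob x]_y h (x, y)).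
Proof.
move=> bh; have [mh [M hM]] := bh.
split; last first.
  exists M => x; apply: bRintegral_norm_le; first exact: bmeas_pair.
  by move=> y; exact: hM.
(* Measurability of kernel integrals is available for nonnegative integrands, hence the shift by
   [M]. *)
pose g z := ((h z + M)%:E)%E.
have bg : bmeas (fun z => h z + M) by bmeas.
have g0 z : (0 <= g z)%E.
  by rewrite lee_fin; have := hM z; rewrite ler_norml => /andP[? _]; lra.
have mg : measurable_fun [set: X * Y] g by apply/measurable_EFinP; case: bg.
have := measurable_fun_integral_finite_kernel g k g0 mg => mI.
rewrite (_ : (fun x => _) = fun x => fine (\int[k x]_y g (x, y)) - M).
  apply: measurable_funB => //.
  by apply: measurableT_comp.
apply/funext => x; rewrite -[fine _]/(\int[kernel_prob x]_y (h (x, y) + M)).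
rewrite bRintegralD ?Rintegral_prob_cst ?addrK//; last exact: bmeas_cst.
exact: bmeas_pair.
Qed.

Local Open Scope ereal_scope.

(** For indicators this is the definition of the coupling. Simple functions follow by linearity, and
    the general case by monotone convergence, used once for the coupling, once for [Q] and once for
    the kernel. *)
Lemma integral_ref_coupling (Q : {finite_measure set X -> \bar R})
    (h : X * Y -> \bar R) :
  (forall z, 0 <= h z) -> measurable_fun [set: X * Y] h ->
  \int[ref_coupling Q k]_z h z = \int[Q]_x \int[k x]_y h (x, y).
Proof.
move=> h0 mh; pose h_ := nnsfun_approx measurableT mh.
have indE (A : set (X * Y)) : measurable A ->
    \int[ref_coupling Q k]_z (\1_A z)%:E = \int[Q]_x \int[k x]_y (\1_A (x, y))%:E.
  move=> mA; rewrite integral_indic// setIT; apply: eq_integral => x _.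
  rewrite [RHS](_ : _ = \int[k x]_y (\1_(xsection A x) y)%:E).
    by rewrite integral_indic ?setIT//; exact: measurable_xsection.
  by apply: eq_integral => y _; rewrite /xsection !indicE mem_setE.
have mp (g : X * Y -> R) x : measurable_fun [set: X * Y] g ->
    measurable_fun [set: Y] (fun y => g (x, y)).
  by move=> mg; exact: (measurableT_comp mg (measurable_pair1 x)).
have mpair (f : {nnsfun (X * Y) >-> R}) x r :
    measurable_fun [set: Y] (fun y => (r * \1_(f @^-1` [set r]) (x, y))%:E).
  apply/measurable_EFinP/measurable_funM => //.
  exact: (mp (\1_(f @^-1` [set r]))).
have mind (f : {nnsfun (X * Y) >-> R}) r : measurable_fun [set: X]
    (fun x => \int[k x]_y (r * \1_(f @^-1` [set r]) (x, y))%:E).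
  apply: (measurable_fun_integral_finite_kernel (fun z => (r * \1_(f @^-1` [set r]) z)%:E) k).
    by move=> z; rewrite nnfun_muleindic_ge0.
  by apply/measurable_EFinP/measurable_funM.
have sE (f : {nnsfun (X * Y) >-> R}) :
    \int[ref_coupling Q k]_z (f z)%:E = \int[Q]_x \int[k x]_y (f (x, y))%:E.
  under [in LHS]eq_integral do rewrite fimfunE -fsumEFin//.
  rewrite ge0_integral_fsum//; last 2 first.
    - by move=> r; apply/measurable_EFinP/measurable_funM.
    - by move=> r z _; rewrite nnfun_muleindic_ge0.
  under [RHS]eq_integral => x _.
    under eq_integral => y _ do rewrite fimfunE -fsumEFin//.
    rewrite ge0_integral_fsum//; [|by move=> r; exact: mpair
      |by move=> r y _; rewrite nnfun_muleindic_ge0].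
    over.
  rewrite [RHS]ge0_integral_fsum//; last 2 first.
    by move=> r; exact: mind.
    by move=> r x _; apply: integral_ge0 => y _; rewrite nnfun_muleindic_ge0.
  apply: eq_fsbigr => r _.
  (* A negative [r] is no value of [f]: its level set is empty and both sides vanish. *)
  have [r0|r0] := leP 0%R r; last first.
    rewrite integral0_eq => [|z _]; last by rewrite preimage_nnfun0// indic0 mulr0.
    rewrite integral0_eq// => x _.
    by rewrite integral0_eq// => y _; rewrite preimage_nnfun0// indic0 mulr0.
  under eq_integral do rewrite EFinM.
  rewrite ge0_integralZl//; last exact/measurable_EFinP.
  rewrite indE//.
  rewrite -ge0_integralZl//; last 2 first.
  - apply: (measurable_fun_integral_finite_kernel (fun z => (\1_(f @^-1` [set r]) z)%:E) k) => //.
    exact/measurable_EFinP.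
  - by move=> x _; apply: integral_ge0.
  apply: eq_integral => x _; rewrite -ge0_integralZl//.
  by apply/measurable_EFinP/(mp (\1_(f @^-1` [set r]))).
have nd m n z : (m <= n)%N -> (h_ m z <= h_ n z)%R.
  by move=> mn; exact/lefP/nd_nnsfun_approx.
transitivity (\int[ref_coupling Q k]_z (lim ((h_ n z)%:E @[n --> \oo]))).
  by apply/eq_integral => z _; apply/esym/cvg_lim => //=; exact: cvg_nnsfun_approx.
rewrite monotone_convergence//; last 3 first.
  by move=> n; exact/measurable_EFinP.
  by move=> n z _; rewrite lee_fin.
  by move=> z _ a b ab; rewrite lee_fin nd.
under eq_fun do rewrite sE.
have mh_ n x : measurable_fun [set: Y] (fun y => (h_ n (x, y))%:E).
  exact/measurable_EFinP/mp.
rewrite -monotone_convergence//; last 3 first.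
- move=> n; apply: (measurable_fun_integral_finite_kernel (fun z => (h_ n z)%:E) k).
    by move=> z; rewrite lee_fin.
  exact/measurable_EFinP.
- by move=> n x _; apply: integral_ge0 => y _; rewrite lee_fin.
- move=> x _ a b ab; apply: ge0_le_integral => //.
  + by move=> y _; rewrite lee_fin.
  + by move=> y _; rewrite lee_fin nd.
apply: eq_integral => x _; rewrite -monotone_convergence//; last 2 first.
- by move=> n y _; rewrite lee_fin.
- by move=> y _ a b ab; rewrite lee_fin nd.
by apply: eq_integral => y _; apply/cvg_lim => //; exact: cvg_nnsfun_approx.
Qed.

Local Close Scope ereal_scope.

(** The nonnegative case for [h + M]; the two contributions of [M] cancel because the coupling has
    the same total mass as [Q]. *)
Lemma Rintegral_ref_coupling (Q : {finite_measure set X -> \bar R}) (h : X * Y -> R) :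
  bmeas h -> \int[ref_coupling Q k]_z h z = \int[Q]_x \int[kernel_prob x]_y h (x, y).
Proof.
move=> bh; have [mh [M hM]] := bh.
have bg : bmeas (fun z => h z + M) by bmeas.
have g0 z : (0 <= h z + M).
  by have := hM z; rewrite ler_norml => /andP[? _]; lra.
have bI := bmeas_kernel_Rintegral bh.
have E : \int[ref_coupling Q k]_z (h z + M) = \int[Q]_x \int[kernel_prob x]_y (h (x, y) + M).
  rewrite /Rintegral integral_ref_coupling//; last by apply/measurable_EFinP; case: bg.
  congr fine; apply: eq_integral => x _.
  by rewrite -/(Rintegral _ _ _) (EFin_Rintegral (kernel_prob x))//; exact: (bmeas_pair x bg).
move: E; rewrite bRintegralD//; last exact: bmeas_cst.
rewrite [X in _ = X -> _](_ : _ = \int[Q]_x (\int[kernel_prob x]_y h (x, y) + M)); last first.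
  apply: eq_Rintegral => x _; rewrite bRintegralD ?Rintegral_prob_cst//; last exact: bmeas_cst.
  exact: bmeas_pair.
rewrite bRintegralD//; last exact: bmeas_cst.
rewrite !Rintegral_cst// => /eqP; rewrite -subr_eq => /eqP <-.
rewrite -addrA -mulrBr (_ : _ - _ = 0) ?mulr0 ?addr0//; apply/eqP; rewrite subr_eq0; apply/eqP.
rewrite [X in fine X = _](_ : _ = Q setT)//.
rewrite /ref_coupling -[RHS]mul1e -integral_cst//; apply: eq_integral => x _.
by rewrite xsectionE preimage_setT prob_kernel.
Qed.

End kernel_expectation.

(** * Relative entropy *)

Section divergence_lower_bound.
Context d (T : measurableType d) (R : realType).
Local Open Scope ereal_scope.

Lemma measurable_lne_EFin (r : T -> R) : measurable_fun [set: T] r ->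
  measurable_fun [set: T] (fun z => lne (r z)%:E).
Proof.
move=> mr; apply: measurable_fun_ifT => //; first exact: measurable_fun_ler.
by apply/measurable_EFinP; apply: measurableT_comp => //; exact: measurable_ln.
Qed.

(** Positive and negative parts are compared separately, so no integrability is asked; it will be
    applied to the logarithm of a density. *)
Lemma ae_le_integral (mu : {measure set T -> \bar R}) (f g : T -> \bar R) :
  measurable_fun [set: T] f -> measurable_fun [set: T] g ->
  {ae mu, forall x, f x <= g x} -> \int[mu]_x f x <= \int[mu]_x g x.
Proof.
move=> mf mg fg; rewrite [leLHS]integralE [leRHS]integralE; apply: leeB.
  apply: ae_ge0_le_integral => //; do ?exact: measurable_funepos.
  by apply: filterS fg => x fgx _; rewrite !funeposE ge_max !le_max fgx lexx/= orbT.
apply: ae_ge0_le_integral => //; do ?exact: measurable_funeneg.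
by apply: filterS fg => x fgx _; rewrite !funenegE ge_max !le_max leeN2 fgx lexx/= orbT.
Qed.

Variables (pi : probability T R) (mu : {finite_measure set T -> \bar R}).

(* The Donsker-Varadhan inequality; [ln r >= g + 1 - expR g / r], where [r] is
   the density of [pi]. *)
Lemma KL_ge_Rintegral (g : T -> R) : bmeas g ->
  (\int[mu]_z expR (g z) <= 1)%R -> (\int[pi]_z g z)%R%:E <= KL pi mu.
Proof.
move=> bg g1; rewrite /KL; case: asboolP => pimu; last exact: leey.
set rn := Radon_Nikodym _ _.
have rnfin z : rn z \is a fin_num by exact: Radon_Nikodym_fin_num.
have mrn : measurable_fun setT rn by by apply: measurable_int; exact: Radon_Nikodym_integrable.
pose r z := fine (rn z).
have rE z : rn z = (r z)%:E by rewrite fineK.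
have mr : measurable_fun setT r by exact: measurableT_comp.
have [mg [M hM]] := bg.
(* [psi] is [expR g / r], set to 0 where the density [r] is not positive. Against [pi] the factor
   [r] cancels, and the integral of [psi] is at most that of [expR g] against [mu]. *)
pose psi z : R := if (0 < r z)%R then expR (g z - ln (r z))%R else 0%R.
have psi0 z : (0 <= psi z)%R.
  by rewrite /psi; case: ifPn => // r0; exact: expR_ge0.
have mpsi : measurable_fun setT psi.
  apply: measurable_fun_ifT => //.
    exact: measurable_fun_ltr.
  apply: measurableT_comp => //; apply: measurable_funB => //.
  by apply: measurableT_comp => //; exact: measurable_ln.
have ipsi1 : \int[pi]_z (psi z)%:E <= 1.
  rewrite -(@Radon_Nikodym_SigmaFinite.change_of_variables _ _ _ pi mu) //; last exact/measurable_EFinP.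
  apply: (@le_trans _ _ (\int[mu]_z (expR (g z))%:E)); last first.
    by rewrite -EFin_Rintegral ?lee_fin//; bmeas.
  apply: ae_le_integral.
  - apply: emeasurable_funM; first exact/measurable_EFinP.
    exact: measurable_int (Radon_Nikodym_SigmaFinite.f_integrable pimu).
  - by apply/measurable_EFinP/measurableT_comp.
  have := ae_eq_Radon_Nikodym_SigmaFinite pimu measurableT.
  apply: filterS => z /(_ I) ->; rewrite -/rn rE -EFinM lee_fin /psi.
  by case: ifPn => r0; [rewrite expRB lnK ?divfK ?gt_eqF|rewrite mul0r expR_ge0].
have ipsi : pi.-integrable setT (EFin \o psi).
  apply/integrableP; split; first exact/measurable_EFinP.
  under eq_integral do rewrite /= ger0_norm//.
  by rewrite (le_lt_trans ipsi1)// ltry.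
have mA : measurable [set z | (r z <= 0)%R].
  have m0 : measurable_fun [set: T] (cst 0%R : T -> R) by [].
  have mt : measurable [set true] by [].
  have := measurable_fun_ler mr m0 measurableT mt.
  by rewrite setTI; congr measurable; apply/seteqP; split => z /=.
(* The mass of this set is the integral of the density over it, which is nonpositive there. Off it,
   [ln r] obeys the pointwise bound. *)
have pi0 : pi [set z | (r z <= 0)%R] = 0.
  apply/eqP; rewrite eq_le measure_ge0 andbT.
  have /= -> := @Radon_Nikodym_integral _ _ _ (charge_of_finite_measure pi) mu _ pimu mA.
  rewrite -/rn integral_mkcond -[leRHS](integral0 mu setT); apply: ae_le_integral => //.
    by apply: (measurable_restrictT _ _).1 => //; exact: measurable_funTS.
  apply: nearW => z; rewrite patchE; case: ifPn => //.
  by rewrite inE /= rE lee_fin.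
pose h z : R := (g z + 1 - psi z)%R.
apply: (@le_trans _ _ (\int[pi]_z (h z)%:E)).
  rewrite /h; under eq_integral do rewrite EFinB.
  rewrite integralB_EFin//; last by apply: bmeas_integrable; bmeas.
  rewrite -EFin_Rintegral; last by bmeas.
  rewrite bRintegralD//; last exact: bmeas_cst.
  rewrite Rintegral_prob_cst EFinD -addeA leeDl//.
  by rewrite sube_ge0 ?orbT.
apply: ae_le_integral.
- by apply/measurable_EFinP; apply: measurable_funB => //; apply: measurable_funD.
- rewrite (_ : (fun z => _) = fun z => lne (r z)%:E); last by apply/funext => z; rewrite -rE.
  exact: measurable_lne_EFin.
exists [set z | (r z <= 0)%R]; split => //.
move=> z /= hz; rewrite leNgt; apply/negP => r0; apply: hz.
rewrite rE lne_EFin// lee_fin /h /psi r0.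
by have := expR_ge1Dx (g z - ln (r z)); lra.
Qed.

End divergence_lower_bound.

Section exp_density.
Context d (T : measurableType d) (R : realType).
Variables (mu : {finite_measure set T -> \bar R}) (g : T -> R).
Hypothesis bg : bmeas g.
Hypothesis g1 : \int[mu]_z expR (g z) = 1.
Local Open Scope ereal_scope.

(** The two proofs are arguments so that the structure of a probability measure can be attached to
    the term itself. *)
Definition exp_density (_ : bmeas g) (_ : (\int[mu]_z expR (g z) = 1)%R) (A : set T) : \bar R :=
  \int[mu]_(z in A) (expR (g z))%:E.

Let D := exp_density bg g1.

Let mexp : measurable_fun setT (fun z => (expR (g z))%:E).
Proof. by apply/measurable_EFinP; apply: measurableT_comp => //; case: bg. Qed.

Let D0 : D set0 = 0. Proof. exact: integral_set0. Qed.

Let D_ge0 A : 0 <= D A.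
Proof. by apply: integral_ge0 => z _; rewrite lee_fin expR_ge0. Qed.

Let D_sigma_additive : semi_sigma_additive D.
Proof.
by apply: semi_sigma_additive_nng_induced => // z; rewrite lee_fin expR_ge0.
Qed.

HB.instance Definition _ := isMeasure.Build _ _ _ (exp_density bg g1)
  D0 D_ge0 D_sigma_additive.

Let D1 : D setT = 1.
Proof. by rewrite /D /exp_density -EFin_Rintegral ?g1//; exact: bmeas_expR. Qed.

HB.instance Definition _ := Measure_isProbability.Build _ _ _ (exp_density bg g1) D1.

Lemma exp_density_dominates : exp_density bg g1 `<< mu.
Proof.
apply/null_content_dominatesP => A mA A0; apply: null_set_integral => //.
exact: measurable_funTS.
Qed.

End exp_density.

Section exp_density_integral.
Context d (T : measurableType d) (R : realType).
Variables (mu : {finite_measure set T -> \bar R}) (g : T -> R).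
Hypothesis bg : bmeas g.
Hypothesis g1 : \int[mu]_z expR (g z) = 1.
Local Open Scope ereal_scope.

Local Notation D := (exp_density bg g1).
Local Notation rn := (Radon_Nikodym (charge_of_finite_measure D) mu).

Let mexp : measurable_fun setT (fun z => (expR (g z))%:E).
Proof. by apply/measurable_EFinP; apply: measurableT_comp => //; case: bg. Qed.

Let mrn : measurable_fun setT rn.
Proof.
by apply: measurable_int; apply: Radon_Nikodym_integrable; exact: exp_density_dominates.
Qed.

Let rn_ae : ae_eq mu setT rn (fun z => (expR (g z))%:E).
Proof.
apply: integral_ae_eq => //.
  by apply: Radon_Nikodym_integrable; exact: exp_density_dominates.
move=> A _ mA; rewrite -Radon_Nikodym_integral//; exact: exp_density_dominates.
Qed.

Lemma Rintegral_exp_density f : bmeas f ->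
  (\int[D]_z f z = \int[mu]_z (f z * expR (g z)))%R.
Proof.
move=> bf; congr fine.
have := @Radon_Nikodym_change_of_variables _ _ _ D mu (exp_density_dominates bg g1)
  _ _ measurableT (bmeas_integrable D bf).
move=> /= <-; apply: ae_eq_integral => //.
- by apply: emeasurable_funM => //; apply/measurable_EFinP; case: bf.
- by apply/measurable_EFinP; apply: (bmeas_meas _); bmeas.
by apply: filterS rn_ae => z /= /[apply] ->.
Qed.

Lemma KL_exp_density : KL D mu = (\int[D]_z g z)%R%:E.
Proof.
rewrite /KL asboolT; last exact: exp_density_dominates.
rewrite EFin_Rintegral//.
have rnE z : rn z = (fine (rn z))%:E.
  by rewrite fineK//; apply: Radon_Nikodym_fin_num; exact: exp_density_dominates.
apply: ae_eq_integral => //.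
- rewrite (_ : (fun z => _) = fun z => lne (fine (rn z))%:E); last by apply/funext => z; rewrite -rnE.
  by apply: measurable_lne_EFin; exact: measurableT_comp.
- by apply/measurable_EFinP; case: bg.
(* The exceptional set is null for [mu], hence also for the measure with density [expR g], against
   which the logarithm is integrated. *)
have [N [mN N0 hN]] := rn_ae.
exists N; split => //.
  by apply: (proj1 (null_content_dominatesP _ _)) N0 => //; exact: exp_density_dominates.
move=> z /= hz; apply: hN => /= h; apply: hz => _.
by rewrite h// lne_EFin ?expR_gt0// expRK.
Qed.

End exp_density_integral.

(** * Duality *)

Section kernel_tilting.
Context d1 d2 (X : measurableType d1) (Y : measurableType d2) (R : realType).
Variable k : R.-pker X ~> Y.
Implicit Types h w : X * Y -> R.

Lemma log_partition_norm_le (mu : probability Y R) u (M : R) :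
  bmeas u -> (forall y, `|u y| <= M) -> `|log_partition mu u| <= M.
Proof.
move=> bu uM; rewrite ler_norml log_partition_le ?andbT//.
  apply: le_trans (log_partition_ge_Rintegral mu bu).
  by apply: bRintegral_ge_cst => // y; have := uM y; rewrite ler_norml => /andP[].
by move=> y; exact: le_trans (ler_norm _) (uM y).
Qed.

Lemma bmeas_kernel_log_partition h : bmeas h ->
  bmeas (fun x => log_partition (kernel_prob k x) (fun y => h (x, y))).
Proof.
move=> bh; split; last first.
  have [_ [M hM]] := bh; exists M => x.
  by apply: log_partition_norm_le => [|y]; [exact: bmeas_pair|exact: hM].
apply: measurableT_comp; first exact: measurable_ln.
exact: bmeas_meas (bmeas_kernel_Rintegral k (bmeas_expR bh)).
Qed.

Lemma tiltE (mu : probability Y R) (u w : Y -> R) : bmeas u ->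
  bmeas w -> tilt mu u w = \int[mu]_y (w y * expR (u y - log_partition mu u)).
Proof.
move=> bu bw; rewrite /tilt -bRintegralZr; last by bmeas.
by apply: eq_Rintegral => y _; rewrite expRB expR_log_partition// mulrA.
Qed.

Lemma bmeas_kernel_tilt h w : bmeas h -> bmeas w ->
  bmeas (fun x => tilt (kernel_prob k x) (fun y => h (x, y)) (fun y => w (x, y))).
Proof.
move=> bh bw; split; last first.
  have [_ [M hM]] := bw; exists M => x.
  by apply: tilt_norm_le => [| |y]; [exact: bmeas_pair|exact: bmeas_pair|exact: hM].
have bJ := bmeas_kernel_log_partition bh.
rewrite (_ : (fun x => _) = fun x =>
    (\int[kernel_prob k x]_y (w (x, y) * expR (h (x, y)))) *
    expR (- log_partition (kernel_prob k x) (fun y => h (x, y)))); last first.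
  by apply/funext => x; rewrite expRN expR_log_partition//; exact: bmeas_pair.
apply: measurable_funM.
  apply: (bmeas_meas _); apply: (bmeas_kernel_Rintegral k (h := fun z => w z * expR (h z))).
  by bmeas.
by apply: (bmeas_meas _); bmeas.
Qed.

Lemma bmeas_fst (f : X -> R) : bmeas f -> bmeas (fun z : X * Y => f z.1).
Proof. by move=> [mf bf]; apply: bmeas_comp. Qed.

Lemma bmeas_snd (f : Y -> R) : bmeas f -> bmeas (fun z : X * Y => f z.2).
Proof. by move=> [mf bf]; apply: bmeas_comp. Qed.

(** The log-density, relative to the reference coupling, of the coupling whose conditional laws are
    tilted by [h]. The normalization is done for each [z.1] separately, which keeps the first
    marginal. *)
Definition tilt_exponent h (z : X * Y) : R :=
  h z - log_partition (kernel_prob k z.1) (fun y => h (z.1, y)).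

Lemma bmeas_tilt_exponent h : bmeas h -> bmeas (tilt_exponent h).
Proof.
move=> bh; apply: bmeasB => //.
exact: (bmeas_fst (bmeas_kernel_log_partition bh)).
Qed.

Lemma Rintegral_tilt_exponent (Q : {finite_measure set X -> \bar R}) h w :
  bmeas h -> bmeas w ->
  \int[ref_coupling Q k]_z (w z * expR (tilt_exponent h z)) =
  \int[Q]_x tilt (kernel_prob k x) (fun y => h (x, y)) (fun y => w (x, y)).
Proof.
move=> bh bw; have bt := bmeas_tilt_exponent bh.
rewrite Rintegral_ref_coupling; last by bmeas.
by apply: eq_Rintegral => x _; rewrite tiltE//; exact: bmeas_pair.
Qed.

Lemma Rintegral_expR_tilt_exponent (Q : {finite_measure set X -> \bar R}) h :
  Q setT = 1%E -> bmeas h ->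
  \int[ref_coupling Q k]_z expR (tilt_exponent h z) = 1.
Proof.
move=> Q1 bh; have := Rintegral_tilt_exponent Q bh (bmeas_cst (1 : R)).
under eq_Rintegral do rewrite mul1r.
move=> ->; rewrite (@eq_Rintegral _ _ _ Q setT (cst 1)) => [|x _]; last first.
  by rewrite (@tilt_cst _ _ _ (kernel_prob k x))//; exact: bmeas_pair.
by rewrite Rintegral_cst// mul1r; exact: (congr1 fine Q1).
Qed.

End kernel_tilting.

Section duality.
Context (R : realType) (X : pmetricType R).
Variables (c : X * X -> R) (pi0 : R.-pker borel X ~> borel X) (eps tau : R).
Hypothesis bc : bmeas (c : borel X * borel X -> R).
Hypothesis c0 : forall x y, 0 <= c (x, y).
Hypotheses (heps : 0 < eps) (htau : 0 <= tau).
Implicit Types (f : X -> R) (lam : R).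

Definition dual_scale lam : R := eps + lam * tau.
Definition dual_exponent lam f (z : borel X * borel X) : R :=
  (f z.2 - lam * c z) / dual_scale lam.

Lemma dual_scale_gt0 lam : 0 <= lam -> 0 < dual_scale lam.
Proof. by move=> l0; rewrite ltr_wpDr// mulr_ge0. Qed.

Lemma bmeas_dual_exponent lam f : bmeas (f : borel X -> R) ->
  bmeas (dual_exponent lam f).
Proof.
move=> bf; apply: bmeasZr; apply: bmeasB; last by bmeas.
exact: (@bmeas_snd _ _ (borel X) (borel X) R f bf).
Qed.

Lemma dual_generatorE lam f x : dual_generator c pi0 eps tau lam f x =
  dual_scale lam * log_partition (kernel_prob pi0 x) (fun z => dual_exponent lam f (x, z)).
Proof. by []. Qed.

Lemma bmeas_dual_generator lam f : bmeas (f : borel X -> R) ->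
  bmeas (dual_generator c pi0 eps tau lam f : borel X -> R).
Proof.
move=> bf; apply: bmeasZ.
exact: (bmeas_kernel_log_partition pi0 (bmeas_dual_exponent lam bf)).
Qed.

(* minus the derivative of [dual_generator] in [lam] *)
Definition dual_slope lam f (x : X) : R :=
  tilt (kernel_prob pi0 x) (fun z => dual_exponent lam f (x, z)) (fun z => c (x, z))
  + tau * tiltKL (kernel_prob pi0 x) (fun z => dual_exponent lam f (x, z)).

Lemma bmeas_dual_slope lam f : bmeas (f : borel X -> R) ->
  bmeas (dual_slope lam f : borel X -> R).
Proof.
move=> bf; have be := bmeas_dual_exponent lam bf.
apply: bmeasD; first exact: (bmeas_kernel_tilt pi0 be bc).
apply: bmeasZ; apply: bmeasB; first exact: (bmeas_kernel_tilt pi0 be be).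
exact: bmeas_kernel_log_partition.
Qed.

Lemma dual_slope_ge0 lam f x : bmeas (f : borel X -> R) -> 0 <= dual_slope lam f x.
Proof.
move=> bf; have be := bmeas_dual_exponent lam bf.
have bex : bmeas (fun z : borel X => dual_exponent lam f (x, z)) := @bmeas_pair _ _ (borel X) (borel X) R _ x be.
have bcx : bmeas (fun z : borel X => c (x, z)) := @bmeas_pair _ _ (borel X) (borel X) R _ x bc.
rewrite /dual_slope; apply: addr_ge0; first exact: (tilt_ge0 (kernel_prob pi0 x) bex bcx (c0 x)).
exact: mulr_ge0 htau (tiltKL_ge0 (kernel_prob pi0 x) bex).
Qed.

(** The Donsker-Varadhan inequality for the normalized dual exponent, multiplied by
    [eps + lam * tau]. Of the resulting divergence terms, [eps] times KL is the penalty in the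
    objective, and [lam * tau] times KL is absorbed, with [lam] times the cost, by [lam] times the
    constraint. *)
Lemma robust_risk_le (Q : {finite_measure set (borel X) -> \bar R}) rho lam f :
  Q setT = 1%E -> 0 <= lam -> bmeas (f : borel X -> R) ->
  (robust_risk c pi0 eps tau rho Q f <=
    (lam * rho + \int[Q]_x dual_generator c pi0 eps tau lam f x)%:E)%E.
Proof.
move=> Q1 l0 bf; have s0 := dual_scale_gt0 l0.
set s := dual_scale lam in s0.
have be := bmeas_dual_exponent lam bf.
apply: ge_ereal_sup => _ [pi [piQ pirho] <-].
set J := fun x : borel X => log_partition (kernel_prob pi0 x) (fun z => dual_exponent lam f (x, z)).
have bJ : bmeas J by exact: bmeas_kernel_log_partition.
have KLge := KL_ge_Rintegral pi (bmeas_tilt_exponent pi0 be).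
move: KLge => /(_ (ref_coupling Q pi0)).
rewrite Rintegral_expR_tilt_exponent// => /(_ (lexx _)).
have bf2 : bmeas (fun z : borel X * borel X => f z.2).
  exact: (@bmeas_snd _ _ (borel X) (borel X) R f bf).
have mf : measurable_fun [set: borel X] (EFin \o f : borel X -> \bar R).
  by apply/measurable_EFinP; case: bf.
rewrite (@integral_pushforward _ _ _ _ _ _ measurable_snd pi setT (EFin \o f))//; last first.
  by rewrite preimage_setT; exact: (bmeas_integrable pi bf2).
rewrite preimage_setT -(EFin_Rintegral pi bf2).
move: pirho; rewrite -(EFin_Rintegral pi bc).
have bJ1 : bmeas (fun z : borel X * borel X => J z.1) := @bmeas_fst _ _ (borel X) (borel X) R J bJ.
have JE : \int[pi]_z J z.1 = \int[Q]_x J x.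
  congr fine; rewrite -[LHS](@integral_pushforward _ _ _ _ _ _ measurable_fst pi setT (EFin \o J))//.
  - by apply: eq_measure_integral => A mA _; exact: piQ.
  - by apply/measurable_EFinP; case: bJ.
  - by rewrite preimage_setT; exact: (bmeas_integrable pi bJ1).
have -> : \int[pi]_z tilt_exponent pi0 (dual_exponent lam f) z =
    (\int[pi]_z f z.2 - lam * \int[pi]_z c z) / s - \int[Q]_x J x.
  rewrite -JE bRintegralB//.
  congr (_ - _); rewrite bRintegralZr; last by bmeas.
  by rewrite bRintegralB ?bRintegralZl//; bmeas.
rewrite [X in (_ <= (_ + X)%:E)%E](_ : _ = s * \int[Q]_x J x); last by rewrite -bRintegralZl.
set A := \int[pi]_z f z.2; set C := \int[pi]_z c z; set B := \int[Q]_x J x.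
case: (KL pi (ref_coupling Q pi0)) => [r| |]//=.
  rewrite -?EFinM -?EFinN -?EFinD !lee_fin lerBlDr ler_pdivrMr// => h1 h2.
  have := ler_wpM2l l0 h1; rewrite /s /dual_scale in h2 *; lra.
(* If the divergence is infinite, the objective is [-oo] because [eps] is positive. *)
by move=> _ _; rewrite gt0_muley ?lte_fin//= addeNy leNye.
Qed.

Let tilted_coupling_integrals (P : probability (borel X) R) lam f
  (bf : bmeas (f : borel X -> R)) : 0 <= lam ->
  let h := dual_exponent lam f in
  exists pi : probability (borel X * borel X)%type R,
  (forall w : borel X * borel X -> R, bmeas w -> \int[pi]_z w z =
    \int[P]_x tilt (kernel_prob pi0 x) (fun y => h (x, y)) (fun y => w (x, y)))
  /\ KL pi (ref_coupling P pi0) = (\int[P]_x tiltKL (kernel_prob pi0 x) (fun y => h (x, y)))%:E.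
Proof.
move=> l0 h; have be := bmeas_dual_exponent lam bf.
have bt := bmeas_tilt_exponent pi0 be.
have P1 : P setT = 1%E by exact: probability_setT.
have t1 := Rintegral_expR_tilt_exponent pi0 P1 be.
exists (exp_density bt t1).
have pE (w : borel X * borel X -> R) : bmeas w -> \int[exp_density bt t1]_z w z =
    \int[P]_x tilt (kernel_prob pi0 x) (fun y => h (x, y)) (fun y => w (x, y)).
  by move=> bw; rewrite Rintegral_exp_density// (Rintegral_tilt_exponent pi0 P be bw).
split => //.
rewrite KL_exp_density pE//; congr EFin; apply: eq_Rintegral => x _.
have bhx : bmeas (fun y : borel X => h (x, y)) := @bmeas_pair _ _ (borel X) (borel X) R _ x be.
rewrite (_ : (fun y => tilt_exponent pi0 h (x, y)) = fun y : borel X => h (x, y) -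
  log_partition (kernel_prob pi0 x) (fun y0 => h (x, y0)))// tiltB//; last exact: bmeas_cst.
by rewrite (tilt_cst (kernel_prob pi0 x) _ bhx).
Qed.

(** The tilted coupling attains the bound: its cost plus [tau] times its divergence is the integral
    of [dual_slope], so the constraint holds with equality and complementary slackness turns the
    objective into the dual value. *)
Lemma robust_risk_ge (P : probability (borel X) R) rho lam f :
  0 <= lam -> bmeas (f : borel X -> R) ->
  \int[P]_x dual_slope lam f x = rho ->
  ((lam * rho + \int[P]_x dual_generator c pi0 eps tau lam f x)%:E <=
    robust_risk c pi0 eps tau rho P f)%E.
Proof.
move=> l0 bf Gr; have s0 := dual_scale_gt0 l0.
have be := bmeas_dual_exponent lam bf.
have [pi [piE KLE]] := tilted_coupling_integrals P bf l0.
have bf2 : bmeas (fun z : borel X * borel X => f z.2).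
  exact: (@bmeas_snd _ _ (borel X) (borel X) R f bf).
set h := dual_exponent lam f in be piE KLE.
have bhx x : bmeas (fun y : borel X => h (x, y)) := @bmeas_pair _ _ (borel X) (borel X) R _ x be.
have bcx x : bmeas (fun y : borel X => c (x, y)) := @bmeas_pair _ _ (borel X) (borel X) R _ x bc.
have bKL : bmeas (fun x : borel X => tiltKL (kernel_prob pi0 x) (fun y => h (x, y))).
  apply: bmeasB; first exact: (bmeas_kernel_tilt pi0 be be).
  exact: bmeas_kernel_log_partition.
have btc := bmeas_kernel_tilt pi0 be bc.
have btf := bmeas_kernel_tilt pi0 be bf2.
apply: ereal_sup_ubound; exists pi.
  split.
    move=> A mA.
    have bA1 : bmeas (\1_A : borel X -> R).
      split; first exact: measurable_indic.
      by exists 1 => x; rewrite indicE ger0_norm//; case: (_ \in _).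
    have bA : bmeas (fun z : borel X * borel X => \1_A z.1 : R).
      exact: (@bmeas_fst _ _ (borel X) (borel X) R \1_A bA1).
    have := congr1 EFin (piE _ bA).
    rewrite (EFin_Rintegral pi)//.
    rewrite (@eq_Rintegral _ _ _ P setT (\1_A : borel X -> R)); last first.
      by move=> x _; exact: (tilt_cst (kernel_prob pi0 x) (\1_A x) (bhx x)).
    rewrite EFin_Rintegral// [X in _ = X -> _]integral_indic// setIT => <-.
    rewrite (_ : (fun z => _) = (fun z => (\1_(@fst (borel X) (borel X) @^-1` A) z)%:E)); last first.
      by apply/funext => z; rewrite !indicE; congr (_%:R%:E); apply/idP/idP; rewrite !inE.
    rewrite integral_indic ?setIT//.
    by rewrite -[X in measurable X]setTI; exact: measurable_fst.
  rewrite -(EFin_Rintegral pi bc) piE// KLE -EFinM -EFinD lee_fin -Gr.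
  by rewrite -bRintegralZl// -bRintegralD//; bmeas.
rewrite (@integral_pushforward _ _ _ _ _ _ measurable_snd pi setT (EFin \o f))//; last 2 first.
- by apply/measurable_EFinP; case: bf.
- by rewrite preimage_setT; exact: (bmeas_integrable pi bf2).
rewrite preimage_setT -(EFin_Rintegral pi bf2) piE// KLE -EFinM -EFinN -EFinD.
have bG := bmeas_dual_slope lam bf; have bD := bmeas_dual_generator lam bf.
congr EFin; rewrite -Gr -[in RHS]bRintegralZl//.
rewrite -bRintegralZl// -bRintegralB//; last by bmeas.
rewrite -[in RHS]bRintegralD//; last exact: bmeasZ.
apply: eq_Rintegral => x _; rewrite dual_generatorE /dual_slope -/h.
have bf' : bmeas (fun y : borel X => f y) by [].
have : dual_scale lam * tilt (kernel_prob pi0 x) (fun y => h (x, y)) (fun y => h (x, y)) =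
   tilt (kernel_prob pi0 x) (fun y => h (x, y)) f -
   lam * tilt (kernel_prob pi0 x) (fun y => h (x, y)) (fun y => c (x, y)).
  rewrite -(tiltZ (kernel_prob pi0 x) _ (bhx x) (bhx x)) -(tiltZ (kernel_prob pi0 x) lam (bhx x) (bcx x)).
  rewrite -(tiltB (kernel_prob pi0 x) (bhx x) bf (bmeasZ lam (bcx x))).
  by congr tilt; apply/funext => y; rewrite /h /dual_exponent mulrC divfK// gt_eqF.
rewrite /tiltKL /dual_scale; lra.
Qed.

End duality.

(** * Derivative of the dual generator and the first-order condition *)

Lemma derive1_quadratic (R : realType) (phi : R -> R) (a g C e : R) : 0 < e ->
  (forall h, `|h| < e -> `|phi (h + a) - phi a - h * g| <= C * h ^+ 2) ->
  derive1 phi a = g.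
Proof.
move=> e0 H; rewrite /derive1; apply: cvg_lim => //.
apply/cvgrPdist_le => /= eta eta0; near=> h.
have hn0 : h != 0 by near: h; exact: nbhs_dnbhs_neq.
have he : `|h| < e.
  near: h; apply: dnbhs0_lt => //.
have hC : `|h| <= eta / (`|C| + 1).
  by near: h; apply: dnbhs0_le; rewrite divr_gt0// ltr_wpDl.
rewrite -normrN opprB (_ : _ - g = h^-1 * (phi (h + a) - phi a - h * g)); last first.
  by rewrite /GRing.scale/=; field.
rewrite normrM normfV mulrC ler_pdivrMr ?normr_gt0//.
apply: (le_trans (H _ he)); rewrite -[h ^+ 2]real_normK ?num_real// expr2 mulrA.
rewrite ler_wpM2r//; apply: (@le_trans _ _ ((`|C| + 1) * `|h|)).
  rewrite ler_wpM2r//; apply: (le_trans (ler_norm _)); lra.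
by rewrite mulrC -ler_pdivlMr// ltr_wpDl.
Unshelve. all: by end_near. Qed.

Section dual_derivative.
Context (R : realType) (X : pmetricType R).
Variables (c : X * X -> R) (pi0 : R.-pker borel X ~> borel X) (eps tau : R).
Hypothesis bc : bmeas (c : borel X * borel X -> R).
Hypothesis c0 : forall x y, 0 <= c (x, y).
Hypotheses (heps : 0 < eps) (htau : 0 <= tau).
Variables (f : X -> R) (M m : R).
Hypothesis bf : bmeas (f : borel X -> R).
Hypothesis fM : forall x, `|f x| <= M.
Hypothesis cm : forall x, \int[pi0 x]_z c (x, z) <= m.

Local Notation phi := (dual_generator c pi0 eps tau).
Local Notation g := (dual_slope c pi0 eps tau).
Local Notation s_ := (dual_scale eps tau).

Let w (lam : R) x := fun z : borel X => f z - lam * c (x, z).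
Let bcx x : bmeas (fun z : borel X => c (x, z)) := @bmeas_pair _ _ (borel X) (borel X) R _ x bc.
Let bw lam x : bmeas (w lam x).
Proof. by rewrite /w; have := bcx x; move=> ?; bmeas. Qed.

Let wB lam lam' x : tilt (kernel_prob pi0 x) (fun z => w lam x z / s_ lam)
    (fun z => w lam' x z - w lam x z) =
  - (lam' - lam) * tilt (kernel_prob pi0 x) (fun z => w lam x z / s_ lam) (fun z => c (x, z)).
Proof.
rewrite -tiltZ//; last exact: bmeasZr.
by congr tilt; apply/funext => z; rewrite /w; lra.
Qed.

Let phiE lam x : perspective (kernel_prob pi0 x) (s_ lam) (w lam x) = phi lam f x.
Proof. by []. Qed.

Let gE lam x : g lam f x =
  tilt (kernel_prob pi0 x) (fun z => w lam x z / s_ lam) (fun z => c (x, z)) +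
  tau * tiltKL (kernel_prob pi0 x) (fun z => w lam x z / s_ lam).
Proof. by []. Qed.

(** Both [f - lam * c] and [eps + lam * tau] are affine in [lam], so convexity in [lam] is inherited
    from the perspective. *)
Lemma dual_generator_subgradient lam lam' x : 0 <= lam -> 0 <= lam' ->
  phi lam f x - (lam' - lam) * g lam f x <= phi lam' f x.
Proof.
move=> l0 l'0.
have := perspective_subgradient (kernel_prob pi0 x) (dual_scale_gt0 heps htau l0)
  (dual_scale_gt0 heps htau l'0) (bw lam x) (bw lam' x).
rewrite wB !phiE gE /dual_scale.
move: (tilt _ _ _) (tiltKL _ _) (phi lam f x) (phi lam' f x) => a b p p'; lra.
Qed.

Let exponentB lam lam' x z : 0 <= lam -> 0 <= lam' ->
  w lam' x z / s_ lam' - w lam x z / s_ lam =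
  - (lam' - lam) * (eps * c (x, z) + tau * f z) / (s_ lam * s_ lam').
Proof.
move=> l0 l'0; have := dual_scale_gt0 heps htau l0; have := dual_scale_gt0 heps htau l'0.
by rewrite /w /dual_scale => s0 s'0; field; rewrite !gt_eqF.
Qed.

Let exponent_lipschitz : exists2 K : R, 0 < K & forall lam lam' x z, 0 <= lam -> 0 <= lam' ->
  `|w lam' x z / s_ lam' - w lam x z / s_ lam| <= `|lam' - lam| * K.
Proof.
have [_ [N hN]] := bc.
have N0 : 0 <= N := le_trans (normr_ge0 _) (hN (point, point)).
have M0 : 0 <= M := le_trans (normr_ge0 _) (fM point).
(* Both scales in the denominator of [exponentB] are at least [eps]; the summand 1 only ensures
   positivity. *)
exists ((eps * N + tau * M) / eps ^+ 2 + 1).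
  by rewrite ltr_wpDl// divr_ge0 ?addr_ge0 ?mulr_ge0 ?exprn_ge0 ?(ltW heps).
move=> lam lam' x z l0 l'0; rewrite exponentB// -mulrA normrM normrN ler_wpM2l//.
have s0 := dual_scale_gt0 heps htau l0; have s'0 := dual_scale_gt0 heps htau l'0.
apply: (@le_trans _ _ ((eps * N + tau * M) / eps ^+ 2)); last by lra.
rewrite normrM; apply: ler_pM => //.
  rewrite (le_trans (ler_normD _ _))// !normrM (gtr0_norm heps) (ger0_norm htau).
  by apply: lerD; [apply: ler_wpM2l (hN (x, z)); exact: ltW|apply: ler_wpM2l].
rewrite normfV gtr0_norm ?mulr_gt0// lef_pV2 ?posrE ?mulr_gt0 ?exprn_gt0//.
by rewrite expr2 ler_pM ?(ltW heps)// /dual_scale lerDl mulr_ge0.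
Qed.

Lemma dual_generator_smooth (L : R) : 0 <= L -> exists e C : R, [/\ 0 < e, 0 <= C &
  forall lam lam' x, 0 <= lam -> 0 <= lam' <= L -> `|lam' - lam| < e ->
  phi lam' f x <= phi lam f x - (lam' - lam) * g lam f x + C * (lam' - lam) ^+ 2].
Proof.
move=> L0; have [K K0 hK] := exponent_lipschitz.
(* The radius keeps the two exponents within [1/3] of each other, as the quadratic bound requires.
   The scale [s_ lam'] multiplies the remainder, whence the upper bound [L] on [lam']. *)
exists (K^-1 / 3), (s_ L * K ^+ 2); split.
- by rewrite divr_gt0 ?invr_gt0.
- by rewrite mulr_ge0 ?exprn_ge0 ?(ltW K0)// ltW// dual_scale_gt0.
move=> lam lam' x l0 /andP[l'0 l'L] ll'.
have r3 : `|lam' - lam| * K <= 1 / 3.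
  by rewrite -ler_pdivlMr// mul1r mulrC ltW.
have s'0 := dual_scale_gt0 heps htau l'0.
have := perspective_smooth (kernel_prob pi0 x) (dual_scale_gt0 heps htau l0)
  s'0 (bw lam x) (bw lam' x) (fun z => hK lam lam' x z l0 l'0) r3.
rewrite wB !phiE gE exprMn real_normK ?num_real//.
have : s_ lam' * ((lam' - lam) ^+ 2 * K ^+ 2) <= s_ L * ((lam' - lam) ^+ 2 * K ^+ 2).
  apply: ler_wpM2r; first by rewrite mulr_ge0 ?sqr_ge0.
  by rewrite lerD2l ler_wpM2r.
move: (tilt _ _ _) (tiltKL _ _) (phi lam f x) (phi lam' f x) => a b p p'.
by rewrite /dual_scale; lra.
Qed.

Lemma derive1_dual_generator lam x : 0 < lam ->
  derive1 (fun l => phi l f x) lam = - g lam f x.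
Proof.
(* With [L = lam + lam] every [lam + h] with [|h| < lam] stays admissible. *)
move=> l0; have [e [C [e0 C0 hC]]] := dual_generator_smooth (addr_ge0 (ltW l0) (ltW l0)).
apply: (@derive1_quadratic _ _ _ _ C (Num.min e lam)); first by rewrite lt_min e0.
move=> h; rewrite lt_min => /andP[he hl].
have hb : - lam < h < lam by rewrite -ltr_norml.
have l'0 : 0 <= h + lam by lra.
have := dual_generator_subgradient x (ltW l0) l'0.
have := hC lam (h + lam) x (ltW l0); rewrite addrK => /(_ _ he).
have -> : 0 <= h + lam <= lam + lam by lra.
move=> /(_ isT).
move: (g lam f x) (phi lam f x) (phi (h + lam) f x) => a p p' h1 h2.
by rewrite ger0_norm; lra.
Qed.

(** The values of the generator cancel when the lower or the upper bounds are added with [lam] and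
    [lam'] exchanged; what remains bounds the product of the two increments by
    [2 * C * (lam' - lam) ^+ 2]. *)
Lemma dual_slope_lipschitz (L : R) : 0 <= L -> exists e C : R, [/\ 0 < e, 0 <= C &
  forall lam lam' x, 0 <= lam <= L -> 0 <= lam' <= L -> `|lam' - lam| < e ->
  `|g lam' f x - g lam f x| <= C * `|lam' - lam|].
Proof.
move=> L0; have [e [C [e0 C0 hC]]] := dual_generator_smooth L0.
exists e, (C + C); split => //; first exact: addr_ge0.
move=> lam lam' x lL l'L ll'; have [->|neq] := eqVneq lam' lam.
  by rewrite !subrr normr0 mulr0.
have /andP[l0 _] := lL; have /andP[l'0 _] := l'L.
have A1 := hC lam lam' x l0 l'L ll'.
have A2 := dual_generator_subgradient x l0 l'0.
have B1 := hC lam' lam x l'0 lL; rewrite distrC in B1; have {}B1 := B1 ll'.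
have B2 := dual_generator_subgradient x l'0 l0.
have d0 : 0 < `|lam' - lam| by rewrite normr_gt0 subr_eq0.
rewrite -(ler_pM2r d0) -mulrA -expr2 real_normK ?num_real// -normrM.
move: (g lam f x) (g lam' f x) (phi lam f x) (phi lam' f x) A1 A2 B1 B2 => a a' p p' *.
rewrite ler_norml.
by apply/andP; split; lra.
Qed.

(** By convexity [phi lam + lam * g lam <= phi 0]. Here [phi 0 <= M], while Jensen's inequality
    gives [phi lam >= - M - lam * m]. *)
Lemma dual_slope_le lam x : 0 < lam -> g lam f x <= m + 2 * M / lam.
Proof.
move=> l0; have := dual_generator_subgradient x (ltW l0) (lexx 0).
have lb : - M - lam * m <= phi lam f x.
  have s0 := dual_scale_gt0 heps htau (ltW l0).
  rewrite dual_generatorE.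
  have bu : bmeas (fun z : borel X => dual_exponent c eps tau lam f (x, z)).
    exact: bmeasZr (bw lam x).
  have := log_partition_ge_Rintegral (kernel_prob pi0 x) bu.
  rewrite -(ler_pM2l s0) => h; apply: (le_trans _ h).
  rewrite -bRintegralZl//.
  rewrite (@eq_Rintegral _ _ _ (kernel_prob pi0 x) setT (w lam x)); last first.
    by move=> z _; rewrite /dual_exponent mulrC divfK// gt_eqF.
  rewrite /w bRintegralB//; last exact: bmeasZ.
  rewrite bRintegralZl//; apply: lerB; last by rewrite ler_wpM2l ?(ltW l0) ?cm.
  by apply: bRintegral_ge_cst => // z; have := fM z; rewrite ler_norml => /andP[].
have ub : phi 0 f x <= M.
  have s0 := dual_scale_gt0 heps htau (lexx 0).
  have bu : bmeas (fun z : borel X => dual_exponent c eps tau 0 f (x, z)).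
    exact: bmeasZr (bw 0 x).
  rewrite dual_generatorE mulrC -ler_pdivlMr//; apply: log_partition_le => // z.
  rewrite /dual_exponent mul0r subr0 ler_pM2r ?invr_gt0//.
  exact: le_trans (ler_norm _) (fM z).
move=> h; have : lam * g lam f x <= lam * m + 2 * M.
  by move: (g lam f x) (phi lam f x) (phi 0 f x) lb ub h => a p p'; lra.
by rewrite mulrC -ler_pdivlMr// mulrDl mulrAC divff ?gt_eqF// mul1r.
Qed.

Lemma exists_dual_optimum (P : probability (borel X) R) (a rho : R) :
  0 < a -> m < rho -> rho <= \int[P]_x g a f x ->
  exists lam, [/\ a <= lam, lam <= 2 * M / (rho - m) & \int[P]_x g lam f x = rho].
Proof.
move=> a0 mrho rhoG; pose G := fun lam => \int[P]_x g lam f x.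
have {}rhoG : rho <= G a := rhoG.
have bg lam : bmeas (g lam f : borel X -> R) := bmeas_dual_slope pi0 eps tau bc lam bf.
have Gle lam : 0 < lam -> G lam <= m + 2 * M / lam.
  by move=> l0; apply: bRintegral_le_cst => // x; exact: dual_slope_le.
have rm0 : 0 < rho - m by rewrite subr_gt0.
(* The point where the bound [m + 2 * M / b] on the slope equals [rho]; the intermediate value
   theorem is applied between [a] and [b]. *)
set b := 2 * M / (rho - m).
have ab : a <= b.
  rewrite /b ler_pdivlMr// mulrC -ler_pdivlMr// lerBlDl.
  exact: le_trans (Gle _ a0).
have b0 : 0 < b by exact: lt_le_trans ab.
have Gb : G b <= rho.
  apply: (le_trans (Gle _ b0)); rewrite /b invf_div mulrCA.
  have M0 : 2 * M != 0 by apply/eqP => M0; move: b0; rewrite /b M0 mul0r ltxx.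
  by rewrite divff// mulr1; lra.
have Gcont : {within `[a, b], continuous G}.
  apply: continuous_in_subspaceT => lam; rewrite inE /= in_itv/= => /andP[al lb].
  have l0 : 0 < lam by exact: lt_le_trans al.
  have [e [C [e0 C0 hC]]] := dual_slope_lipschitz (addr_ge0 (ltW b0) (ltW b0)).
  apply/cvgrPdist_le => /= eta eta0; near=> lam'.
  have l1 : `|lam' - lam| < e by rewrite distrC; near: lam'; exact: cvgr_dist_lt.
  have l2 : `|lam' - lam| < lam by rewrite distrC; near: lam'; exact: cvgr_dist_lt.
  have l3 : `|lam' - lam| <= eta / (C + 1).
    by rewrite distrC; near: lam'; apply: cvgr_dist_le => //; rewrite divr_gt0// ltr_wpDl.
  have hb : - lam < lam' - lam < lam by rewrite -ltr_norml.
  have lB : 0 <= lam <= b + b by rewrite (ltW l0) (le_trans lb)// lerDl ltW.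
  have l'B : 0 <= lam' <= b + b.
    move: hb; rewrite ltrBrDr addNr ltrBlDr => /andP[/ltW-> /ltW h] /=.
    by rewrite (le_trans h)// lerD.
  rewrite distrC -bRintegralB//; apply: bRintegral_norm_le; first exact: bmeasB.
  move=> x; apply: le_trans (hC lam lam' x lB l'B l1) _.
  apply: (@le_trans _ _ ((C + 1) * `|lam' - lam|)); first by rewrite ler_wpM2r// lerDl.
  by rewrite mulrC -ler_pdivlMr// ltr_wpDl.
have Gmm : Num.min (G a) (G b) <= rho <= Num.max (G a) (G b).
  by apply/andP; split; [rewrite ge_min; apply/orP; right|rewrite le_max; apply/orP; left].
have [lam] := IVT ab Gcont Gmm.
rewrite in_itv/= => /andP[al lb] Glam; exists lam; split => //.
Unshelve. all: by end_near. Qed.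

End dual_derivative.

(** * Lipschitz dependence of the dual generator *)

Section rescaled_generator.
Context (R : realType) (X : pmetricType R).
Variables (c : X * X -> R) (pi0 : R.-pker borel X ~> borel X) (eps tau : R).
Hypothesis bc : bmeas (c : borel X * borel X -> R).
Hypothesis c0 : forall x y, 0 <= c (x, y).
Hypotheses (heps : 0 < eps) (htau : 0 <= tau).
Variable m : R.
Hypothesis cm : forall x, \int[pi0 x]_z c (x, z) <= m.
Implicit Types (f : X -> R) (theta : R).

(* [dual_generator lam f / lam] as a function of [theta = 1 / lam], in which it
   is Lipschitz. *)
Definition rescaled_generator theta f (x : X) : R :=
  perspective (kernel_prob pi0 x) (eps * theta + tau)
    (fun z : borel X => theta * f z - c (x, z)).

Local Notation Phi := rescaled_generator.
Local Notation s_ theta := (eps * theta + tau).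
Let w theta f x := fun z : borel X => theta * f z - c (x, z).

Let bcx x : bmeas (fun z : borel X => c (x, z)) := @bmeas_pair _ _ (borel X) (borel X) R _ x bc.
Let bw theta f x : bmeas (f : borel X -> R) -> bmeas (w theta f x).
Proof. by move=> bf; apply: bmeasB; [exact: bmeasZ|exact: bcx]. Qed.

Let s_gt0 theta : 0 < theta -> 0 < s_ theta.
Proof. by move=> t0; rewrite ltr_wpDr// mulr_gt0. Qed.

(** Homogeneity of the perspective: the scale [eps + lam * tau] and the function [f - lam * c] are
    both [lam] times their rescaled versions. *)
Lemma dual_generator_rescaled lam f x : 0 < lam ->
  dual_generator c pi0 eps tau lam f x = lam * Phi lam^-1 f x.
Proof.
move=> l0; have s0 : 0 < eps / lam + tau by apply: s_gt0; rewrite invr_gt0.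
have s1 : 0 < eps + lam * tau by rewrite ltr_wpDr// mulr_ge0// ltW.
have sE : dual_scale eps tau lam = lam * (eps * lam^-1 + tau).
  by rewrite /dual_scale; field; rewrite gt_eqF.
rewrite dual_generatorE /Phi /perspective mulrA -sE; congr (_ * _).
congr log_partition; apply/funext => z; rewrite /dual_exponent sE.
by field; rewrite !gt_eqF//; move: s1; lra.
Qed.

Lemma bmeas_rescaled_generator theta f : bmeas (f : borel X -> R) ->
  bmeas (Phi theta f : borel X -> R).
Proof.
move=> bf; have b2 : bmeas (fun z : borel X * borel X => f z.2).
  exact: (@bmeas_snd _ _ (borel X) (borel X) R f bf).
have bh : bmeas (fun z : borel X * borel X => (theta * f z.2 - c z) / s_ theta).
  by apply: bmeasZr; apply: bmeasB => //; exact: bmeasZ.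
exact: bmeasZ (bmeas_kernel_log_partition pi0 bh).
Qed.

Lemma rescaled_generator_le theta f (M : R) x : 0 < theta -> bmeas (f : borel X -> R) ->
  (forall z, f z <= M) -> Phi theta f x <= theta * M.
Proof.
move=> t0 bf fM; have s0 := s_gt0 t0.
rewrite /Phi /perspective mulrC -ler_pdivlMr//; apply: log_partition_le.
  exact: bmeasZr (bw theta x bf).
move=> z; rewrite ler_pM2r ?invr_gt0// lerBlDr.
by apply: (@le_trans _ _ (theta * M)); [rewrite ler_pM2l|rewrite lerDl].
Qed.

(** By Jensen's inequality the cost enters through its conditional mean only, so the range has
    length [2 * theta * M + m] whatever the maximum of [c] is. *)
Lemma rescaled_generator_ge theta f (M : R) x : 0 < theta -> bmeas (f : borel X -> R) ->
  (forall z, - M <= f z) -> - (theta * M) - m <= Phi theta f x.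
Proof.
move=> t0 bf fM; have s0 := s_gt0 t0.
have := log_partition_ge_Rintegral (kernel_prob pi0 x) (bmeasZr (s_ theta)^-1 (bw theta x bf)).
rewrite -(ler_pM2l s0) bRintegralZr; last exact: bw.
rewrite mulrCA divff ?gt_eqF// mulr1 => h; apply: (le_trans _ h).
rewrite bRintegralB//; last exact: bmeasZ.
apply: lerB; last exact: cm.
by apply: bRintegral_ge_cst => [|z]; [exact: bmeasZ|rewrite -mulrN ler_pM2l].
Qed.

Let lipschitz_f1 theta f f' (r : R) x : 0 < theta ->
  bmeas (f : borel X -> R) -> bmeas (f' : borel X -> R) ->
  (forall z, `|f z - f' z| <= r) -> Phi theta f x - theta * r <= Phi theta f' x.
Proof.
move=> t0 bf bf' fr; have s0 := s_gt0 t0.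
have := perspective_subgradient (kernel_prob pi0 x) s0 s0 (bw theta x bf) (bw theta x bf').
rewrite subrr mul0r subr0 => h; apply: (le_trans _ h); rewrite lerD2l.
have bu := bmeasZr (s_ theta)^-1 (bw theta x bf).
rewrite -[leLHS](tilt_cst (kernel_prob pi0 x) _ bu); apply: le_tilt => //.
- exact: bmeas_cst.
- by apply: bmeasB; exact: bw.
move=> z; rewrite [leRHS](_ : _ = - (theta * (f z - f' z))); last by rewrite /w; ring.
rewrite lerN2 ler_pM2l//; exact: le_trans (ler_norm _) (fr z).
Qed.

Lemma rescaled_generator_lipschitz_f theta f f' (r : R) x : 0 < theta ->
  bmeas (f : borel X -> R) -> bmeas (f' : borel X -> R) ->
  (forall z, `|f z - f' z| <= r) -> `|Phi theta f x - Phi theta f' x| <= theta * r.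
Proof.
move=> t0 bf bf' fr; have h1 := lipschitz_f1 x t0 bf bf' fr.
have h2 : Phi theta f' x - theta * r <= Phi theta f x.
  by apply: lipschitz_f1 => // z; rewrite distrC.
by rewrite ler_norml; lra.
Qed.

(** The slope in [theta] is [t - eps * kl], with [t] the tilted mean of [f] and [kl] the divergence
    of the tilted law. Jensen's inequality and [0 <= c] bound [kl] through [klu]. *)
Let lipschitz_theta1 (tmin : R) theta theta' f (M : R) x : 0 < tmin -> tmin <= theta -> 0 < theta' ->
  bmeas (f : borel X -> R) -> (forall z, `|f z| <= M) ->
  Phi theta f x - (M + m * eps / (eps * tmin + tau)) * `|theta' - theta| <= Phi theta' f x.
Proof.
have aux (th s uu t' e c' J C m' : R) : s * uu = th * t' - c' -> 0 <= c' -> C <= m' ->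
    th * e - C <= J * s -> s * (uu - J) <= th * (t' - e) + m' by move=> *; lra.
move=> tm0 tmt t'0 bf fM; have t0 : 0 < theta by exact: lt_le_trans tmt.
have s0 := s_gt0 t0; have sm0 := s_gt0 tm0.
have bu := bmeasZr (s_ theta)^-1 (bw theta x bf).
have := perspective_subgradient (kernel_prob pi0 x) s0 (s_gt0 t'0) (bw theta x bf) (bw theta' x bf).
set u := fun z => w theta f x z / s_ theta in bu *.
rewrite (_ : (fun z => _ - _) = fun z => (theta' - theta) * f z); last first.
  by apply/funext => z; rewrite /w; lra.
rewrite (tiltZ _ (theta' - theta) bu bf); set t := tilt _ _ _; set kl := tiltKL _ _.
rewrite (_ : s_ theta' - s_ theta = (theta' - theta) * eps); last by ring.
have bfx : bmeas (fun z : borel X => f z) by [].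
have tM : `|t| <= M by exact: tilt_norm_le.
have kl0 : 0 <= kl by exact: tiltKL_ge0.
set E := \int[kernel_prob pi0 x]_z f z.
have fE : `|E| <= M by exact: bRintegral_norm_le.
have m0 : 0 <= m by apply: le_trans (cm x); apply: Rintegral_ge0.
have klu : s_ theta * kl <= theta * (t - E) + m.
  have := log_partition_ge_Rintegral (kernel_prob pi0 x) bu.
  rewrite bRintegralZr; last exact: bw.
  rewrite bRintegralB//; last exact: bmeasZ.
  rewrite bRintegralZl// ler_pdivrMr// -/E.
  have tu : s_ theta * tilt (kernel_prob pi0 x) u u = theta * t - tilt (kernel_prob pi0 x) u (fun z => c (x, z)).
    rewrite -(tiltZ _ _ bu bu) -(tiltZ _ theta bu bf) -(tiltB _ bu (bmeasZ theta bf) (bcx x)).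
    by congr tilt; apply/funext => z; rewrite /u mulrC divfK// gt_eqF.
  have tc0 : 0 <= tilt (kernel_prob pi0 x) u (fun z => c (x, z)) by exact: tilt_ge0.
  by rewrite /kl /tiltKL; exact: (aux _ _ _ _ _ _ _ _ _ tu tc0 (cm x)).
have third_ge : m * eps / s_ theta <= m * eps / (eps * tmin + tau).
  rewrite ler_wpM2l ?mulr_ge0 ?(ltW heps)// lef_pV2 ?posrE//.
  by rewrite lerD2r ler_pM2l.
(* After multiplication by [s_ theta = eps * theta + tau], the term [eps * theta * t] cancels
   against the one in [klu], leaving [tau * t + eps * theta * E - eps * m]; so [M] appears with
   coefficient 1. *)
have slope_ge : - (M + m * eps / s_ theta) <= t - eps * kl.
  rewrite -(ler_pM2l s0) mulrN mulrDr [s_ theta * (_ / _)]mulrCA divff ?gt_eqF// mulr1.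
  move: tM fE; rewrite !ler_norml => /andP[tM1 tM2] /andP[EM1 EM2].
  have h1 := ler_wpM2l htau tM1.
  have h2 : eps * theta * - M <= eps * theta * E by rewrite ler_wpM2l// mulr_ge0 ?ltW.
  have h3 := ler_wpM2l (ltW heps) klu.
  by lra.
have slope_le : t - eps * kl <= M + m * eps / s_ theta.
  have h1 : 0 <= m * eps / s_ theta by rewrite divr_ge0 ?mulr_ge0 ?(ltW heps) ?(ltW s0).
  have h2 : 0 <= eps * kl by rewrite mulr_ge0// ltW.
  apply: (@le_trans _ _ t); first by rewrite gerBl.
  by rewrite (le_trans (le_trans (ler_norm _) tM))// lerDl.
move=> h; apply: (le_trans _ h); rewrite -addrA lerD2l.
rewrite (_ : _ * t - _ * kl = (theta' - theta) * (t - eps * kl)); last by ring.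
rewrite lerNl -mulrN.
apply: le_trans (ler_norm _) _; rewrite normrM normrN mulrC ler_wpM2r//.
rewrite ler_norml; apply/andP; split.
  by apply: le_trans slope_ge; rewrite lerN2 lerD2l.
by apply: (le_trans slope_le); rewrite lerD2l.
Qed.

Lemma rescaled_generator_lipschitz_theta (tmin : R) theta theta' f (M : R) x :
  0 < tmin -> tmin <= theta -> tmin <= theta' ->
  bmeas (f : borel X -> R) -> (forall z, `|f z| <= M) ->
  `|Phi theta f x - Phi theta' f x| <=
    (M + m * eps / (eps * tmin + tau)) * `|theta - theta'|.
Proof.
move=> tm0 tmt tmt' bf fM.
have h1 := lipschitz_theta1 x tm0 tmt (lt_le_trans tm0 tmt') bf fM.
have h2 := lipschitz_theta1 x tm0 tmt' (lt_le_trans tm0 tmt) bf fM.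
rewrite distrC in h1; rewrite ler_norml lerBlDr -lerBlDl h1.
by rewrite lerNl opprB lerBlDr -lerBlDl h2.
Qed.

End rescaled_generator.

(** * Concentration *)

Section independent_product.
Context d d' (Omega : measurableType d) (T : measurableType d') (R : realType).
Variables (Pr : probability Omega R) (P : probability T R).
Variables (n : nat) (xi : 'I_n -> {RV Pr >-> T}).
Hypothesis hxi : iid_from xi P.

Let Rintegral_indic_prod (B : 'I_n -> set T) : (forall i, measurable (B i)) ->
  \int[Pr]_w (\prod_(i < n) \1_(B i) (xi i w)) = \prod_(i < n) fine (P (B i)).
Proof.
move=> mB.
have mA : measurable (\bigcap_(i in [set: 'I_n]) (xi i @^-1` B i)).
  apply: fin_bigcap_measurable => // i _.
  by rewrite -[X in measurable X]setTI; exact: measurable_funP.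
have -> : \int[Pr]_w (\prod_(i < n) \1_(B i) (xi i w)) =
    \int[Pr]_w \1_(\bigcap_(i in [set: 'I_n]) (xi i @^-1` B i)) w.
  apply: eq_Rintegral => w _; rewrite !indicE.
  have [wA|wA] := boolP (w \in _).
    rewrite big1// => i _; rewrite indicE mem_set//.
    by move: wA; rewrite inE => /(_ i I).
  have [i hi] : exists i, ~ B i (xi i w).
    apply: contrapT => /forallNP h; move/negP: wA; apply; rewrite inE => i _.
    exact: contrapT (h i).
  by rewrite (bigD1 i)//= indicE memNset// mul0r.
rewrite /Rintegral integral_indic// setIT; have /= -> := hxi.1 B mB.
rewrite (eq_bigr (fun i => (fine (P (B i)))%:E)) => [|i _]; last first.
  by rewrite fineK ?fin_num_measure//; exact: (hxi.2 i (B i) (mB i)).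
by rewrite prodEFin.
Qed.

Let bmeas_xi (phi : T -> R) i : bmeas phi -> bmeas (fun w => phi (xi i w)).
Proof. by move=> [mphi bphi]; apply: bmeas_comp. Qed.

Let bmeas_indic (B : set T) : measurable B -> bmeas (\1_B : T -> R).
Proof.
move=> mB; split; first exact: measurable_indic.
by exists 1 => x; rewrite indicE ger0_norm//; case: (_ \in _).
Qed.

Let Rintegral_simple_prod (K : nat) (a : 'I_K -> R) (B : 'I_K -> set T) :
  (forall j, measurable (B j)) ->
  \int[Pr]_w (\prod_(i < n) \sum_(j < K) a j * \1_(B j) (xi i w)) =
  (\int[P]_x \sum_(j < K) a j * \1_(B j) x) ^+ n.
Proof.
move=> mB.
rewrite bRintegral_sum; last by move=> j; apply: bmeasZ; exact: bmeas_indic.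
under eq_Rintegral do rewrite bigA_distr_bigA/=.
rewrite bRintegral_sum; last first.
  by move=> f; apply: bmeas_prod => i; apply: bmeasZ; apply: bmeas_xi; exact: bmeas_indic.
transitivity (\sum_(f : {ffun 'I_n -> 'I_K}) \prod_(i < n) (a (f i) * fine (P (B (f i))))).
  apply: eq_bigr => f _; rewrite big_split/= -Rintegral_indic_prod//.
  rewrite -bRintegralZl.
    by apply: eq_Rintegral => w _; rewrite big_split.
  by apply: bmeas_prod => i; apply: bmeas_xi; exact: bmeas_indic.
rewrite -(bigA_distr_bigA (fun (i : 'I_n) (j : 'I_K) => a j * fine (P (B j)))) prodr_const card_ord.
congr (_ ^+ _); apply: eq_bigr => j _; rewrite bRintegralZl; last exact: bmeas_indic.
by rewrite /Rintegral integral_indic// setIT.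
Qed.

(** Independence is stated for events. So [phi] is rounded up to a multiple of [eta], hence the
    [j.+1] in [a]; the product of sums of indicators is expanded, and [eta] tends to 0. An upper
    bound is all that the exponential moment method requires. *)
Lemma Rintegral_prod_le (phi : T -> R) : bmeas phi -> (forall x, 0 <= phi x) ->
  \int[Pr]_w (\prod_(i < n) phi (xi i w)) <= (\int[P]_x phi x) ^+ n.
Proof.
move=> bphi phi0; have [mphi [N hN]] := bphi.
have step (eta : R) : 0 < eta ->
    \int[Pr]_w (\prod_(i < n) phi (xi i w)) <= (\int[P]_x phi x + eta) ^+ n.
  move=> eta0; pose K := (Num.truncn (N / eta)).+1.
  pose B (j : 'I_K) := [set x | Num.truncn (phi x / eta) = j].
  have mB j : measurable (B j).
    rewrite (_ : B j = phi @^-1` `[j%:R * eta, j.+1%:R * eta[).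
      by rewrite -[X in measurable X]setTI; exact: mphi.
    apply/seteqP; split => x /=; rewrite /B/= in_itv/= -ler_pdivlMr// -ltr_pdivrMr//.
      by move=> <-; apply: truncn_itv; rewrite divr_ge0// ltW.
    by move=> h; apply/truncn_def.
  pose a (j : 'I_K) := eta * j.+1%:R.
  have simpleE x : \sum_(j < K) a j * \1_(B j) x = eta * (Num.truncn (phi x / eta)).+1%:R.
    have xK : (Num.truncn (phi x / eta) < K)%N.
      rewrite ltnS; apply: le_truncn; rewrite ler_pM2r ?invr_gt0//.
      exact: le_trans (ler_norm _) (hN x).
    rewrite (bigD1 (Ordinal xK))//= indicE mem_set// mulr1 big1 ?addr0// => j jx.
    rewrite indicE memNset ?mulr0// /B/= => xj; move/eqP: jx; apply.
    exact/val_inj.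
  have le_simple x : phi x <= \sum_(j < K) a j * \1_(B j) x <= phi x + eta.
    rewrite simpleE; have := @truncn_itv R (phi x / eta).
    rewrite divr_ge0 ?(ltW eta0)// => /(_ isT).
    rewrite ler_pdivlMr// ltr_pdivrMr// => /andP[h1 h2].
    by rewrite mulrC (ltW h2)/= -natr1 mulrDl mul1r lerD2r.
  have bs : bmeas (fun x => \sum_(j < K) a j * \1_(B j) x).
    by apply: bmeas_sum => j; apply: bmeasZ; exact: bmeas_indic.
  apply: (@le_trans _ _ ((\int[P]_x \sum_(j < K) a j * \1_(B j) x) ^+ n)).
    rewrite -Rintegral_simple_prod//; apply: le_bRintegral.
    - by apply: bmeas_prod => i; exact: bmeas_xi.
    - by apply: bmeas_prod => i; exact: (bmeas_xi i bs).
    move=> w; apply: ler_prod => i _; rewrite phi0/=.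
    by have /andP[] := le_simple (xi i w).
  rewrite lerXn2r ?nnegrE//.
  - by apply: Rintegral_ge0 => x _; have /andP[h _] := le_simple x; exact: le_trans h.
  - by rewrite addr_ge0 ?(ltW eta0)//; apply: Rintegral_ge0.
  rewrite -[X in _ + X](Rintegral_prob_cst P) -bRintegralD//; last exact: bmeas_cst.
  apply: le_bRintegral => //; first by apply: bmeasD => //; exact: bmeas_cst.
  by move=> x; have /andP[] := le_simple x.
have cont : (\int[P]_x phi x + eta) ^+ n @[eta --> (0:R)^'+] --> (\int[P]_x phi x) ^+ n.
  have : (\int[P]_x phi x + eta) ^+ n @[eta --> (0:R)] --> (\int[P]_x phi x + 0) ^+ n.
    apply: (cvg_comp (fun eta => \int[P]_x phi x + eta) (fun y => y ^+ n)); last exact: exprn_continuous.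
    by apply: cvgD; [exact: cvg_cst|exact: cvg_id].
  by rewrite addr0; apply: cvg_at_right_filter.
apply: (cvgr_to_ge cont); near=> eta; apply: step; near: eta.
exact: nbhs_right_gt.
Unshelve. all: by end_near. Qed.

End independent_product.

Lemma is_derive_le_linear (R : realType) (f df : R -> R) (K h : R) :
  (forall x : R, is_derive x (1 : R) f (df x)) -> 0 <= h ->
  (forall x, 0 <= x -> df x <= K) -> f h <= f 0 + K * h.
Proof.
move=> fd h0 dfK.
have [|c ch] := MVT_segment h0 (fun x _ => fd x).
  apply: continuous_subspaceT => x; apply/differentiable_continuous/derivable1_diffP.
  by have [] := fd x.
rewrite subr0 => /eqP; rewrite subr_eq addrC => /eqP ->; rewrite lerD2l ler_wpM2r//.
by apply: dfK; move: ch; rewrite in_itv/= => /andP[].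
Qed.

Section hoeffding_scalar.
Context (R : realType) (p : R).
Hypothesis p01 : 0 <= p <= 1.

Let L x : R := 1 - p + p * expR x.

Let L0 x : 0 < L x.
Proof.
have /andP[p0 p1] := p01; rewrite /L; have [->|pn] := eqVneq p 0.
  by rewrite subr0 mul0r addr0.
have pp : 0 < p * expR x by rewrite mulr_gt0 ?expR_gt0// lt_def pn.
by rewrite ltr_wpDl// subr_ge0.
Qed.

Let dL (x : R) : is_derive x (1 : R) L (p * expR x).
Proof.
have -> : L = cst (1 - p) + p *: expR by apply/funext => y.
have := is_deriveD (is_derive_cst (1 - p) x (1 : R)) (is_deriveZ p (is_derive_expR x)).
by rewrite add0r.
Qed.

(** The left side is a logistic function [q], with derivative [q * (1 - q) <= 1/4]; the last
    inequality is [4 a b <= (a + b) ^+ 2] for [a = 1 - p] and [b = p * expR x]. *)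
Let logistic_le h : 0 <= h -> p * expR h / L h <= p + h / 4.
Proof.
move=> h0; pose q x := 1 - (1 - p) * (L x)^-1.
have qE x : p * expR x / L x = q x.
  by rewrite /q -[X in X - _](divff (lt0r_neq0 (L0 x))) -mulrBl; congr (_ / _); rewrite /L; ring.
have q0 : q 0 = p by rewrite -qE /L expR0; field; rewrite subrK oner_neq0.
rewrite qE -q0 (_ : h / 4 = 1 / 4 * h); last by lra.
apply: (@is_derive_le_linear _ q (fun x => (1 - p) * (p * expR x) / (L x) ^+ 2) (1 / 4) h _ h0) => x.
  have Ln0 := lt0r_neq0 (L0 x).
  have dV : is_derive x (1 : R) (fun y => (L y)^-1) (- (L x) ^- 2 *: (p * expR x)).
    by apply: is_deriveV; [exact: Ln0|exact: dL].
  have -> : q = cst 1 - (1 - p) *: (fun y => (L y)^-1) by apply/funext => y.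
  have := is_deriveB (is_derive_cst (1 : R) x (1 : R)) (is_deriveZ (1 - p) dV).
  by move=> h1; apply: (is_derive_eq h1); rewrite /GRing.scale/=; ring.
move=> x0; rewrite ler_pdivrMr ?exprn_gt0//.
have : 0 <= (1 - p - p * expR x) ^+ 2 by exact: sqr_ge0.
rewrite /L !expr2; lra.
Qed.

(** The quotient [D] of the two sides equals 1 at 0, and its derivative is nonpositive because
    [logistic_le] bounds the logarithmic derivative of [L]. *)
Lemma hoeffding_scalar h : 0 <= h -> 1 - p + p * expR h <= expR (p * h + h ^+ 2 / 8).
Proof.
move=> h0; pose D x := L x * expR (- (p * x + x ^+ 2 / 8)).
suff : D h <= D 0 + 0 * h.
  rewrite mul0r addr0 /D /L expR0 mulr0 expr0n/= mul0r addr0 oppr0 expR0 !mulr1 subrK.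
  by rewrite expRN ler_pdivrMr ?expR_gt0// mul1r.
apply: (@is_derive_le_linear _ D (fun x => (p * expR x - (p + x / 4) * L x) *
    expR (- (p * x + x ^+ 2 / 8))) 0 h _ h0) => x.
  have dE : is_derive x (1 : R) (fun y => - (p * y + y ^+ 2 / 8)) (- (p + x / 4)).
    rewrite (_ : (fun y => _) = - (p *: id + 8^-1 *: (id ^+ 2)) :> (R -> R)); last first.
      by apply/funext => y /=; rewrite !fctE/= [y ^+ 2 / 8]mulrC.
    have h1 := is_deriveN (is_deriveD (is_deriveZ p (is_derive_id x (1 : R)))
      (is_deriveZ 8^-1 (is_deriveX 2 (is_derive_id x (1 : R))))).
    by apply: (is_derive_eq h1); rewrite /GRing.scale/=; field.
  have dE2 := @is_derive1_comp _ expR _ x _ _ (is_derive_expR _) dE.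
  have -> : D = L * (expR \o (fun y => - (p * y + y ^+ 2 / 8))) by apply/funext => y.
  have h1 := is_deriveM (dL x) dE2.
  by apply: (is_derive_eq h1); rewrite /GRing.scale/=; field.
move=> x0; rewrite mulr_le0_ge0 ?expR_ge0// subr_le0 -ler_pdivrMr//.
exact: logistic_le.
Qed.

End hoeffding_scalar.

Section hoeffding.
Context d d' (Omega : measurableType d) (T : measurableType d') (R : realType).
Variables (Pr : probability Omega R) (P : probability T R).

Lemma hoeffding_mgf (g : T -> R) (a b t : R) : bmeas g -> a < b ->
  (forall x, a <= g x <= b) -> 0 <= t ->
  \int[P]_x expR (t * (g x - \int[P]_y g y)) <= expR (t ^+ 2 * (b - a) ^+ 2 / 8).
Proof.
move=> bg ab gab t0; set e := \int[P]_y g y.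
have ba0 : 0 < b - a by rewrite subr_gt0.
have eab : a <= e <= b.
  apply/andP; split; [apply: bRintegral_ge_cst|apply: bRintegral_le_cst] => // x;
  by have /andP[] := gab x.
pose p := (e - a) / (b - a).
have p01 : 0 <= p <= 1.
  have /andP[ae eb] := eab; apply/andP; split; first by rewrite divr_ge0 ?subr_ge0 ?(ltW ab).
  by rewrite ler_pdivrMr// mul1r lerD2r.
(* convexity: [expR] lies below its chord between the endpoints *)
have chord x : expR (t * (g x - a)) <= 1 - (g x - a) / (b - a) +
    (g x - a) / (b - a) * expR (t * (b - a)).
  have /andP[ag gb] := gab x.
  set q := (g x - a) / (b - a).
  have q01 : 0 <= q <= 1.
    apply/andP; split; first by rewrite divr_ge0 ?subr_ge0 ?(ltW ab).
    by rewrite ler_pdivrMr// mul1r lerD2r.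
  have /andP[q0 q1] := q01.
  have -> : t * (g x - a) = q * (t * (b - a)).
    by rewrite /q; field; rewrite gt_eqF.
  set s := t * (b - a); set E := expR (q * s).
  have h1 : E * (1 + (s - q * s)) <= expR s.
    have := expR_ge1Dx (s - q * s).
    by rewrite -(ler_pM2l (expR_gt0 (q * s))) -expRD [q * s + _]addrC subrK.
  have h2 : E * (1 + - (q * s)) <= 1.
    have := expR_ge1Dx (- (q * s)).
    by rewrite -(ler_pM2l (expR_gt0 (q * s))) -expRD subrr expR0.
  have := ler_wpM2l q0 h1; have q1' : 0 <= 1 - q by rewrite subr_ge0.
  have := ler_wpM2l q1' h2.
  by rewrite mulr1; move: E (expR s) h1 h2 => {}E S _ _ h3 h4; lra.
have bx : bmeas (fun x => (g x - a) / (b - a)) by bmeas.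
have -> : \int[P]_x expR (t * (g x - e)) =
    expR (- (t * (e - a))) * \int[P]_x expR (t * (g x - a)).
  rewrite -bRintegralZl; last by bmeas.
  by apply: eq_Rintegral => x _; rewrite -expRD; congr expR; ring.
have up : \int[P]_x expR (t * (g x - a)) <= 1 - p + p * expR (t * (b - a)).
  apply: le_trans (le_bRintegral _ _ _ chord) _; try by bmeas.
  rewrite bRintegralD; try by bmeas.
  rewrite bRintegralB; try by bmeas.
  rewrite Rintegral_prob_cst [X in _ + X <= _]bRintegralZr//.
  suff -> : \int[P]_x ((g x - a) / (b - a)) = p by [].
  rewrite bRintegralZr; last by bmeas.
  by rewrite bRintegralB; try bmeas; rewrite Rintegral_prob_cst.
have := hoeffding_scalar p01 (mulr_ge0 t0 (ltW ba0)).
move=> /(le_trans up) {}up.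
apply: (@le_trans _ _ (expR (- (t * (e - a))) * expR (p * (t * (b - a)) + (t * (b - a)) ^+ 2 / 8))).
  by rewrite ler_pM2l ?expR_gt0.
rewrite -expRD ler_expR /p; rewrite le_eqVlt; apply/orP; left; apply/eqP; field.
by rewrite gt_eqF.
Qed.

Variables (n : nat) (xi : 'I_n -> {RV Pr >-> T}).
Hypothesis hxi : iid_from xi P.
Hypothesis n0 : (0 < n)%N.

Definition centered_mean (g : T -> R) (w : Omega) : R :=
  n%:R^-1 * (\sum_(i < n) g (xi i w)) - \int[P]_x g x.

Lemma bmeas_centered_mean (g : T -> R) : bmeas g -> bmeas (centered_mean g).
Proof.
move=> bg; apply: bmeasB; last exact: bmeas_cst.
apply: bmeasZ; apply: bmeas_sum => i.
by have [mg hg] := bg; apply: bmeas_comp.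
Qed.

Lemma hoeffding (g : T -> R) (a b r : R) : bmeas g -> a < b ->
  (forall x, a <= g x <= b) -> 0 <= r ->
  (Pr [set w | (r < centered_mean g w)%R] <=
    (expR (- (2 * n%:R * r ^+ 2 / (b - a) ^+ 2)))%:E)%E.
Proof.
move=> bg ab gab r0; set e := \int[P]_y g y.
have ba0 : 0 < b - a by rewrite subr_gt0.
have nR : 0 < n%:R :> R by rewrite ltr0n.
(* The minimizer of the exponent [- t * n * r + n * t ^+ 2 * (b - a) ^+ 2 / 8]. *)
pose t := 4 * r / (b - a) ^+ 2.
have t0 : 0 <= t by rewrite divr_ge0 ?mulr_ge0 ?exprn_ge0 ?(ltW ba0).
set A := [set w | _].
have bm := bmeas_centered_mean bg.
have mA : measurable A.
  have m0 : measurable_fun [set: Omega] (cst r : Omega -> R) by [].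
  have mt : measurable [set true] by [].
  have := measurable_fun_ltr m0 (bmeas_meas bm) measurableT mt.
  by rewrite setTI; congr measurable; apply/seteqP; split => z /=.
have bA : bmeas (\1_A : Omega -> R).
  split; first exact: measurable_indic.
  by exists 1 => x; rewrite indicE ger0_norm//; case: (_ \in _).
have bphi : bmeas (fun x => expR (t * (g x - e))) by bmeas.
have bprod : bmeas (fun w => \prod_(i < n) expR (t * (g (xi i w) - e))).
  by apply: bmeas_prod => i; have [mphi hphi] := bphi; apply: (bmeas_comp _ mphi hphi).
have -> : Pr A = (\int[Pr]_w \1_A w)%:E.
  by rewrite EFin_Rintegral// integral_indic// setIT.
rewrite lee_fin.
apply: (@le_trans _ _ (\int[Pr]_w (expR (- (t * n%:R * r)) *
    \prod_(i < n) expR (t * (g (xi i w) - e))))).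
  apply: le_bRintegral => //; first exact: bmeasZ.
  move=> w; rewrite indicE; have [wA|wA] := boolP (w \in A); last first.
    by rewrite mulr_ge0 ?expR_ge0// prodr_ge0// => i _; exact: expR_ge0.
  rewrite -expR_sum -expRD -[leLHS]expR0 ler_expR -mulr_sumr sumrB sumr_const card_ord.
  move: wA; rewrite inE /A/= /centered_mean -/e => h.
  have h2 : r * n%:R <= \sum_(i < n) g (xi i w) - e *+ n.
    rewrite lerBrDr -[e *+ n]mulr_natr -mulrDl -ler_pdivlMr// -lerBrDr.
    by rewrite [X in _ <= X - _]mulrC; exact: ltW.
  by have := ler_wpM2l t0 h2; lra.
rewrite bRintegralZl//.
apply: (@le_trans _ _ (expR (- (t * n%:R * r)) * expR (t ^+ 2 * (b - a) ^+ 2 / 8) ^+ n)).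
  rewrite ler_pM2l ?expR_gt0//; apply: le_trans (Rintegral_prod_le hxi bphi _) _.
    by move=> x; exact: expR_ge0.
  rewrite lerXn2r ?nnegrE ?expR_ge0//; last exact: hoeffding_mgf.
  by apply: Rintegral_ge0 => x _; exact: expR_ge0.
rewrite -expRM_natl -expRD ler_expR /t; rewrite le_eqVlt; apply/orP; left; apply/eqP; field.
by rewrite gt_eqF.
Qed.

End hoeffding.

(** * Chaining *)

Section chaining.
Context d d' (Omega : measurableType d) (T : measurableType d') (R : realType).
Variables (Pr : probability Omega R) (P : probability T R).
Variables (n : nat) (xi : 'I_n -> {RV Pr >-> T}).
Hypothesis hxi : iid_from xi P.
Hypothesis n0 : (0 < n)%N.

Local Notation W := (centered_mean P xi).

Lemma centered_meanB (g g' : T -> R) w : bmeas g -> bmeas g' ->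
  W (fun x => g x - g' x) w = W g w - W g' w.
Proof.
move=> bg bg'; rewrite /centered_mean bRintegralB// sumrB mulrBr.
by rewrite opprD opprK addrACA opprD opprK.
Qed.

Lemma centered_mean_le (g : T -> R) (r : R) w : bmeas g -> (forall x, `|g x| <= r) ->
  W g w <= 2 * r.
Proof.
move=> bg gr; have nR : 0 < n%:R :> R by rewrite ltr0n.
have h1 : n%:R^-1 * (\sum_(i < n) g (xi i w)) <= r.
  rewrite mulrC ler_pdivrMr// mulr_natr -[X in _ *+ X]card_ord -sumr_const.
  by apply: ler_sum => i _; exact: le_trans (ler_norm _) (gr _).
have h2 : - r <= \int[P]_x g x.
  by apply: bRintegral_ge_cst => // x; have := gr x; rewrite ler_norml => /andP[].
by rewrite /centered_mean; lra.
Qed.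

Let measurable_exceed (g : T -> R) (r : R) : bmeas g ->
  measurable [set w | r < W g w].
Proof.
move=> bg.
have m0 : measurable_fun [set: Omega] (cst r : Omega -> R) by [].
have mt : measurable [set true] by [].
have := measurable_fun_ltr m0 (bmeas_meas (bmeas_centered_mean P xi bg)) measurableT mt.
by rewrite setTI; congr measurable; apply/seteqP; split => z /=.
Qed.

Section level.
Variables (N : nat) (g : 'I_N -> T -> R) (wd kappa L : R).
Hypothesis bg : forall j, bmeas (g j).
Hypothesis wd0 : 0 < wd.
Hypothesis gwd : forall j, exists a, forall x, a <= g j x <= a + wd.
Hypothesis L0 : 0 <= L.
Hypothesis kappa1 : 1 <= kappa.

(** With [u] the factor in parentheses, Hoeffding's inequality gives the tail [expR (- u ^+ 2)]. As
    [u ^+ 2 >= ln N + kappa * L], the first term pays for the union over [N] functions and the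
    second is the gain. *)
Definition level_threshold : R :=
  wd / Num.sqrt 2 * (Num.sqrt (ln N%:R) + kappa * Num.sqrt L).

Definition level_bad : set Omega :=
  \bigcup_(j in [set: 'I_N]) [set w | level_threshold / Num.sqrt n%:R < W (g j) w].

Lemma measurable_level_bad : measurable level_bad.
Proof. by apply: fin_bigcup_measurable => // j _; exact: measurable_exceed. Qed.

Lemma level_bad_le : (Pr level_bad <= (expR (- (kappa * L)))%:E)%E.
Proof.
have [N0|N0] := posnP N.
  rewrite (_ : level_bad = set0) ?measure0 ?lee_fin ?expR_ge0//.
  by apply/seteqP; split => // w [[j jN] _ _]; move: jN; rewrite N0.
have N1 : 1 <= N%:R :> R by rewrite ler1n.
have nR : 0 < n%:R :> R by rewrite ltr0n.
have s2 : 0 < Num.sqrt 2 :> R by rewrite sqrtr_gt0.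
have t0 : 0 <= level_threshold / Num.sqrt n%:R.
  rewrite divr_ge0// mulr_ge0 ?divr_ge0 ?(ltW wd0)//.
  by rewrite addr_ge0// mulr_ge0 ?sqrtr_ge0// (le_trans ler01).
have each j : (Pr [set w | (level_threshold / Num.sqrt n%:R < W (g j) w)%R] <=
    (N%:R^-1 * expR (- (kappa * L)))%:E)%E.
  have [a ga] := gwd j.
  have aw : a < a + wd by rewrite ltrDl.
  apply: (le_trans (hoeffding hxi n0 (bg j) aw ga t0)).
  rewrite lee_fin -[N%:R in leRHS]lnK ?posrE ?ltr0n// -expRN -expRD ler_expR.
  rewrite -opprD lerN2.
  rewrite (_ : 2 * _ * _ / _ = (Num.sqrt (ln N%:R) + kappa * Num.sqrt L) ^+ 2); last first.
    rewrite [a + wd - a]addrC addKr /level_threshold.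
    rewrite !exprMn !exprVn !sqr_sqrtr ?ler0n//.
    by field; rewrite !gt_eqF//= ltr0n.
  rewrite sqrrD exprMn !sqr_sqrtr ?ln_ge0//.
  have k0 : 0 <= kappa := le_trans ler01 kappa1.
  have h1 : kappa * L <= kappa ^+ 2 * L.
    by rewrite ler_wpM2r// expr2 ler_peMr.
  have h2 : 0 <= Num.sqrt (ln N%:R) * (kappa * Num.sqrt L) by rewrite mulr_ge0 ?mulr_ge0.
  by rewrite mulr2n; lra.
apply: (@le_trans _ _ (\sum_(j < N) (N%:R^-1 * expR (- (kappa * L)))%:E)%E); last first.
  rewrite sumEFin lee_fin sumr_const card_ord -[leLHS]mulr_natl mulrA divff ?mul1r//.
  by rewrite gt_eqF// (lt_le_trans ltr01).
have -> : (\sum_(j < N) (N%:R^-1 * expR (- (kappa * L)))%:E =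
    \sum_(j \in [set: 'I_N]) (N%:R^-1 * expR (- (kappa * L)))%:E)%E.
  rewrite (fsbigE (index_enum 'I_N)) ?index_enum_uniq//=; last first.
    by move=> i _; rewrite mem_index_enum.
  by apply: eq_bigl => j; rewrite in_setT.
apply: (@le_trans _ _ (\sum_(j \in [set: 'I_N])
    Pr [set w | (level_threshold / Num.sqrt n%:R < W (g j) w)%R])%E).
  apply: content_sub_fsum; [exact: finite_finset| |exact: measurable_level_bad|by []].
  by move=> j _; exact: measurable_exceed.
by apply: lee_fsum => [|j _]; [exact: finite_finset|exact: each].
Qed.

End level.

Variables (I : Type) (C : set I) (h : I -> T -> R).
Variables (N : nat -> nat) (pt : forall k, 'I_(N k) -> I).
Variables (e0 b delta U : R).
Hypothesis bh : forall t, C t -> bmeas (h t).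
Hypothesis pt_in : forall k j, C (@pt k j).
Hypothesis net : forall k t, C t ->
  exists j : 'I_(N k), forall x, `|h t x - h (pt j) x| <= e0 / 2 ^+ k.
Hypothesis e00 : 0 < e0.
Hypothesis range : forall t, C t -> exists a, forall x, a <= h t x <= a + 12 * e0.
Hypothesis delta01 : 0 < delta < 1.
Hypothesis U_ge : forall K, 6 * Num.sqrt 2 *
    (\sum_(k < K) e0 / 2 ^+ k * Num.sqrt (ln (N k)%:R)) +
  12 * e0 * Num.sqrt (2 * ln (2 / delta)) <= U.

Let L := ln (2 / delta).
Let e k : R := e0 / 2 ^+ k.

Let L0 : 0 <= L.
Proof.
have /andP[d0 d1] := delta01; rewrite ln_ge0// ler_pdivlMr// mul1r.
by rewrite (le_trans (ltW d1))// ler1n.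
Qed.

Let parent k (j : 'I_(N k.+1)) : 'I_(N k) := sval (cid (net k (pt_in j))).

Let parentP k (j : 'I_(N k.+1)) x : `|h (pt j) x - h (pt (parent j)) x| <= e k.
Proof. exact: (svalP (cid (net k (pt_in j))) x). Qed.

Let link k : 'I_(N k) -> T -> R :=
  match k with
  | 0 => fun j => h (pt j)
  | k'.+1 => fun j x => h (pt j) x - h (pt (parent j)) x
  end.

(** A link to a parent at level [k] is bounded by [e k] in absolute value, so its range has length
    [2 * e k = 4 * e k.+1]. *)
Let width k : R := if k is k'.+1 then 4 * e k'.+1 else 12 * e0.

(** The factor [k.+1] makes the failure probability at level [k] at most [(delta / 2) ^+ k.+1];
    these sum to at most [delta]. *)
Let bad k := level_bad (@link k) (width k) k.+1%:R L.

Let blink k j : bmeas (@link k j).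
Proof.
by case: k j => [|k] j /=; [exact/bh/pt_in|apply: bmeasB; exact/bh/pt_in].
Qed.

Let e_gt0 k : 0 < e k.
Proof. by rewrite divr_gt0 ?exprn_gt0. Qed.

Let eS k : 2 * e k.+1 = e k.
Proof. by rewrite /e exprS; field; rewrite expf_neq0. Qed.

Let bad_le k : (Pr (bad k) <= ((delta / 2) ^+ k.+1)%:E)%E.
Proof.
have /andP[d0 d1] := delta01.
have -> : (delta / 2) ^+ k.+1 = expR (- (k.+1%:R * L)).
  rewrite -mulrN expRM_natl /L -lnV ?posrE ?divr_gt0// invf_div lnK// posrE.
  by rewrite divr_gt0.
apply: level_bad_le => //.
- by rewrite /width; case: k => [|k]; rewrite mulr_gt0.
- case: k => [|k] j /=; first exact/range/pt_in.
  exists (- e k) => x; have := parentP j x; rewrite ler_norml => /andP[h1 h2].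
  by rewrite h1/=; have := eS k; lra.
- by rewrite ler1n.
Qed.

Let mbad k : measurable (bad k).
Proof. exact: measurable_level_bad. Qed.

Let Pr_bad : (Pr (\bigcup_k bad k) <= delta%:E)%E.
Proof.
have /andP[d0 d1] := delta01.
apply: (@le_trans _ _ (\sum_(0 <= k <oo) Pr (bad k))%E).
  by apply: measure_sigma_subadditive => //; exact: bigcup_measurable.
apply: lime_le; first exact: is_cvg_nneseries.
apply: nearW => K; apply: (@le_trans _ _ (\sum_(0 <= k < K) ((delta / 2) ^+ k.+1)%:E)%E).
  by apply: lee_sum => k _; exact: bad_le.
rewrite sumEFin lee_fin.
set x := delta / 2; have x0 : 0 < x by rewrite divr_gt0.
have x1 : 2 * x <= 1 by rewrite /x; lra.
suff : \sum_(0 <= k < K) x ^+ k.+1 + 2 * x ^+ K.+1 <= 2 * x.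
  have := exprn_ge0 K.+1 (ltW x0); rewrite /x; lra.
elim: K => [|K ih]; first by rewrite big_nil add0r expr1.
rewrite big_nat_recr//= (le_trans _ ih)// -addrA lerD2l.
rewrite [X in _ + 2 * X]exprS mulrA.
have := exprn_ge0 K.+1 (ltW x0) => xK.
have := ler_wpM2r xK x1; lra.
Qed.

(** The accumulated thresholds. The coefficient of the entropy terms is 6 at the base and 2 at the
    links, bounded by 6. In the [L] part the base gives [6 * e0] and the links sum to
    [6 * e0 - 2 * e k * (k + 3)]. The total stays below [12 * e0], exactly the range of the base
    functions: this is why the base scale is a twelfth of the range. *)
Let V k : R := 6 * Num.sqrt 2 * (\sum_(i < k.+1) e i * Num.sqrt (ln (N i)%:R)) +
  Num.sqrt 2 * Num.sqrt L * (12 * e0 - 2 * e k * (k%:R + 3)).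

Let s2 : Num.sqrt 2 * Num.sqrt 2 = 2 :> R.
Proof. by rewrite -expr2 sqr_sqrtr. Qed.

Let s2_gt0 : 0 < Num.sqrt 2 :> R.
Proof. by rewrite sqrtr_gt0. Qed.

Let thresholdE (wd kappa M : R) : wd / Num.sqrt 2 * (M + kappa * Num.sqrt L) =
  Num.sqrt 2 * (wd / 2) * (M + kappa * Num.sqrt L).
Proof.
congr (_ * _); apply: (mulIf (lt0r_neq0 s2_gt0)).
by rewrite divfK ?gt_eqF// mulrAC s2; lra.
Qed.

Let net_bound k w : (forall i, ~ bad i w) ->
  forall j, W (h (@pt k j)) w <= V k / Num.sqrt n%:R.
Proof.
move=> gw; elim: k => [|k ih] j.
  have : ~ level_threshold (N 0) (12 * e0) 1 L / Num.sqrt n%:R < W (h (pt j)) w.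
    by move=> hb; apply: (gw 0); exists j.
  move/negP; rewrite -leNgt => /le_trans; apply.
  rewrite ler_wpM2r ?invr_ge0 ?sqrtr_ge0// /level_threshold thresholdE /V big_ord1 /e expr0 divr1.
  by rewrite mul1r; lra.
have : ~ level_threshold (N k.+1) (4 * e k.+1) k.+2%:R L / Num.sqrt n%:R <
    W (fun x => h (pt j) x - h (pt (parent j)) x) w.
  by move=> hb; apply: (gw k.+1); exists j.
move/negP; rewrite -leNgt centered_meanB; [|exact/bh/pt_in|exact/bh/pt_in].
rewrite lerBlDr => /le_trans; apply.
apply: (le_trans (lerD (lexx _) (ih (parent j)))); rewrite -mulrDl.
rewrite ler_wpM2r ?invr_ge0 ?sqrtr_ge0// /level_threshold thresholdE.
have l0 : 0 <= Num.sqrt 2 * (e k.+1 * Num.sqrt (ln (N k.+1)%:R)).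
  by rewrite !mulr_ge0 ?sqrtr_ge0// ltW.
pose S := \sum_(i < k.+1) e i * Num.sqrt (ln (N i)%:R).
have -> : V k = 6 * Num.sqrt 2 * S + Num.sqrt 2 * Num.sqrt L * (12 * e0 - 2 * (2 * e k.+1) * (k%:R + 3)).
  by rewrite eS.
have -> : V k.+1 = 6 * Num.sqrt 2 * (S + e k.+1 * Num.sqrt (ln (N k.+1)%:R)) +
    Num.sqrt 2 * Num.sqrt L * (12 * e0 - 2 * e k.+1 * (k%:R + 1 + 3)).
  by rewrite /V big_ord_recr/= natr1.
have -> : k.+2%:R = k%:R + 2 :> R by rewrite -addn2 natrD.
move: (Num.sqrt 2) (Num.sqrt L) (e k.+1) (Num.sqrt (ln _)) S l0 => a q ek l S l0.
lra.
Qed.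

Lemma chaining : exists2 E : set Omega, measurable E /\ ((1 - delta)%:E <= Pr E)%E &
  forall w, E w -> forall t, C t -> W (h t) w <= U / Num.sqrt n%:R.
Proof.
have mB : measurable (\bigcup_k bad k) by exact: bigcup_measurable.
exists (~` \bigcup_k bad k).
  split; first exact: measurableC.
  rewrite probability_setC// EFinB leeB//.
move=> w gw t Ct.
have {}gw i : ~ bad i w by move=> bi; apply: gw; exists i.
have sn : 0 < Num.sqrt n%:R :> R by rewrite sqrtr_gt0 ltr0n.
(* The step from [t] to its net point is bounded for every sample by [2 * e k], and [k] is
   arbitrary. *)
have step k : W (h t) w <= U / Num.sqrt n%:R + 2 * e k.
  have [j hj] := net k Ct.
  have := centered_mean_le w (bmeasB (bh Ct) (bh (pt_in j))) hj.
  rewrite centered_meanB; [|exact: bh|exact/bh/pt_in].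
  rewrite lerBlDr addrC => /le_trans; apply; rewrite lerD2r.
  apply: (le_trans (net_bound gw j)); rewrite ler_pM2r ?invr_gt0//.
  apply: le_trans (U_ge k.+1); rewrite lerD2l sqrtrM// mulrC -/L.
  rewrite mulrC mulrA [leRHS]mulrC ler_wpM2l ?mulr_ge0 ?sqrtr_ge0// gerBl.
  by rewrite !mulr_ge0 ?addr_ge0// ltW.
apply/ler_addgt0Pr => eta eta0.
have [k hk] : exists k, 2 * e k <= eta.
  exists (Num.bound (2 * e0 / eta)).
  rewrite /e mulrA ler_pdivrMr ?exprn_gt0// [leRHS]mulrC -ler_pdivrMr//.
  apply: ltW; apply: (lt_le_trans (archi_boundP _)).
    by rewrite divr_ge0 ?mulr_ge0 ?(ltW e00) ?(ltW eta0).
  by rewrite -natrX ler_nat ltnW// ltn_expl.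
by apply: (le_trans (step k)); rewrite lerD2l.
Qed.

End chaining.

(** * Packing numbers and entropy *)

Section packing.
Context (R : realType) (X : pmetricType R).
Implicit Types (F : set (X -> R)) (f g : X -> R).

Definition packing F (t : R) (n : nat) (g : 'I_n -> X -> R) :=
  (forall i, F (g i)) /\
  forall i j, i != j -> t <= supnorm (fun x => g i x - g j x).

Lemma supnormB f g : supnorm (fun x => f x - g x) = supnorm (fun x => g x - f x).
Proof. by congr sup; congr image; apply/funext => x; rewrite distrC. Qed.

(** A packing of maximal size is a net: a function at distance at least [t] from all its members
    could be added to it. *)
Lemma maximal_packing F t : packing_number F t \is a fin_num ->
  exists n (g : 'I_n -> X -> R),
    [/\ packing_number F t = n%:R%:E, forall i, F (g i) &
        forall f, F f -> exists i, supnorm (fun x => f x - g i x) < t].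
Proof.
move=> pfin; pose S n := exists g : 'I_n -> X -> R, packing F t g.
have S_le n : S n -> (n%:R%:E <= packing_number F t)%E.
  by move=> Sn; apply: ereal_sup_ubound; exists n.
have [B hB] : exists B, forall n, S n -> (n <= B)%N.
  exists (Num.truncn (fine (packing_number F t))) => n /S_le.
  by rewrite -(fineK pfin) lee_fin => /le_truncn; rewrite natrK.
have exS : exists n, `[< S n >].
  by exists 0%N; apply/asboolP; unshelve eexists; [case|split=> -[]].
have [n /asboolP[g [Fg sep]] nmax] := ex_maxnP exS (fun n Sn => hB n (asboolW Sn)).
exists n, g; split => //.
  apply/eqP; rewrite eq_le S_le ?andbT; last by exists g.
  apply: ge_ereal_sup => _ [k Sk <-]; rewrite lee_fin ler_nat.
  by apply: nmax; apply/asboolP.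
move=> f Ff; apply: contrapT => /forallNP hf.
have {}hf i : t <= supnorm (fun x => f x - g i x) by rewrite leNgt; apply/negP.
suff /asboolP/nmax : S n.+1 by rewrite ltnn.
pose g' (i : 'I_n.+1) := if unlift ord_max i is Some j then g j else f.
exists g'; split; first by move=> i; rewrite /g'; case: unliftP.
move=> i j ij; rewrite /g'; case: unliftP ij => [i' ->|->]; case: unliftP => [j' ->|->].
- by rewrite (inj_eq lift_inj) => ij; exact: sep.
- by move=> _; rewrite supnormB.
- by move=> _.
- by rewrite eqxx.
Qed.

Lemma packing_number_ge1 F f t : F f -> (1 <= packing_number F t)%E.
Proof.
move=> Ff; apply: ereal_sup_ubound; exists 1%N => //.
by exists (fun=> f); split => // i j; rewrite !ord1 eqxx.
Qed.

Lemma packing_number_nonincreasing F s t : s <= t ->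
  (packing_number F t <= packing_number F s)%E.
Proof.
move=> st; apply: ereal_sup_le => _ [n [g [Fg sep]] <-]; exists n => //.
by exists g; split => // i j ij; exact: le_trans (sep _ _ ij).
Qed.

End packing.

Section monotone_integral.
Context d (T : measurableType d) (R : realType) (mu : {measure set T -> \bar R}).

(** Integrals of nonnegative functions are suprema over simple functions below them, so they compare
    without any measurability, in particular for the integrand of [dudley_entropy]. *)
Lemma ge0_le_integral_set (f1 : T -> \bar R) (D : set T) (f2 : T -> \bar R) :
  (forall x, 0 <= f1 x)%E -> (forall x, D x -> 0 <= f2 x)%E ->
  (forall x, D x -> f1 x <= f2 x)%E -> (forall x, ~ D x -> f1 x = 0%E) ->
  (\int[mu]_x f1 x <= \int[mu]_(x in D) f2 x)%E.
Proof.
move=> f10 f20 f12 f1D; rewrite [leRHS]integral_mkcond.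
have le x : (f1 x <= (f2 \_ D) x)%E.
  rewrite patchE; case: ifPn => [|]; rewrite ?inE; first exact: f12.
  by rewrite notin_setE => /f1D ->.
rewrite !ge0_integralTE//; last by move=> x; exact: le_trans (le x).
by apply: ereal_sup_le => _ [h hf <-]; exists h => // x; exact: le_trans (le x).
Qed.

End monotone_integral.

Section entropy.
Context (R : realType) (X : pmetricType R).
Variables (F : set (X -> R)) (f0 : X -> R).
Hypothesis Ff0 : F f0.
Hypothesis hdudley : (dudley_entropy F < +oo)%E.

Let phi t : \bar R := sqrte (lne (packing_number F t)).

Let phi_ge0 t : (0 <= phi t)%E.
Proof. exact: sqrte_ge0. Qed.

Let phi_nonincreasing s t : s <= t -> (phi t <= phi s)%E.
Proof.
move=> st; rewrite /phi lee_sqrt ?lne_ge0 ?(packing_number_ge1 _ Ff0)//.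
rewrite lee_lne ?packing_number_nonincreasing// in_itv/= leey andbT.
  by rewrite (le_trans _ (packing_number_ge1 _ Ff0)).
by rewrite (le_trans _ (packing_number_ge1 _ Ff0)).
Qed.

(** An infinite value at [t] makes the integrand infinite on the whole of []0, t]]; it then
    dominates [r / t] there, so the entropy exceeds every [r]. *)
Lemma packing_number_fin t : 0 < t -> packing_number F t \is a fin_num.
Proof.
move=> t0; rewrite ge0_fin_numE; last by rewrite (le_trans _ (packing_number_ge1 _ Ff0)).
rewrite ltey; apply/eqP => pt; move: hdudley; apply/negP; rewrite -leNgt leye_eq.
apply/eqP/eqyP => r r0.
have -> : r = r / t * t by rewrite divfK ?gt_eqF.
have -> : ((r / t * t)%:E = \int[@lebesgue_measure R]_x ((r / t) * \1_(`]0, t]%classic) x)%:E)%E.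
  under eq_integral do rewrite EFinM.
  rewrite ge0_integralZl//; last by rewrite lee_fin divr_ge0// ltW.
    have muI : lebesgue_measure (`]0, t]%classic : set R) = t%:E.
      by rewrite lebesgue_measure_itv/= lte_fin t0 oppr0 adde0.
    by rewrite integral_indic// setIT; rewrite EFinM; congr (_ * _)%E; rewrite -[LHS]muI.
  by apply/measurable_EFinP/measurable_indic.
apply: ge0_le_integral_set.
- by move=> x; rewrite lee_fin mulr_ge0 ?divr_ge0 ?(ltW r0) ?(ltW t0)// indicE ler0n.
- by move=> x _; exact: phi_ge0.
- move=> x _; rewrite indicE; have [|] := boolP (x \in _); last first.
    by move=> _; rewrite mulr0; exact: phi_ge0.
  rewrite inE/= in_itv/= => /andP[x0 xt]; apply: le_trans (phi_nonincreasing xt).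
  by rewrite /phi pt leey.
- move=> x /= x0; rewrite indicE memNset ?mulr0// => /=; rewrite !in_itv/= in x0 *.
  by case/andP => h; rewrite h in x0.
Qed.

(** The integrand is nonincreasing, so on []t / 2 ^+ k.+1, t / 2 ^+ k]] it is at least its value at
    the right end. The interval has half the length of the weight [t / 2 ^+ k], whence the factor
    2. *)
Lemma dyadic_entropy_le (t : R) (N : nat -> nat) K : 0 < t ->
  (forall k, packing_number F (t / 2 ^+ k) = (N k)%:R%:E) ->
  \sum_(k < K) t / 2 ^+ k * Num.sqrt (ln (N k)%:R) <= 2 * fine (dudley_entropy F).
Proof.
move=> t0 NE.
have NR k : 1 <= (N k)%:R :> R by rewrite -lee_fin -NE (packing_number_ge1 _ Ff0).
have phiE k : phi (t / 2 ^+ k) = (Num.sqrt (ln (N k)%:R))%:E.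
  rewrite /phi NE lne_EFin ?(lt_le_trans ltr01)//.
pose A k : set R := `]t / 2 ^+ k.+1, t / 2 ^+ k]%classic.
pose a k : R := Num.sqrt (ln (N k)%:R).
have a0 k : 0 <= a k by exact: sqrtr_ge0.
have half k : t / 2 ^+ k - t / 2 ^+ k.+1 = t / 2 ^+ k / 2.
  by rewrite exprS; field; rewrite expf_neq0.
have muA k : lebesgue_measure (A k) = (t / 2 ^+ k / 2)%:E.
  rewrite lebesgue_measure_itv/= lte_fin -subr_gt0 half divr_gt0 ?divr_gt0 ?exprn_gt0//.
  by rewrite -EFinB half.
have mA k : measurable (A k) by exact: measurable_itv.
have ind0 k x : 0 <= a k * \1_(A k) x by rewrite mulr_ge0// indicE ler0n.
have mind k : measurable_fun [set: R] (fun x => (a k * \1_(A k) x)%:E).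
  by apply/measurable_EFinP/measurable_funM => //; exact: measurable_indic.
have key : (\int[@lebesgue_measure R]_x (\sum_(k < K) (a k * \1_(A k) x)%:E) =
    (\sum_(k < K) a k * (t / 2 ^+ k / 2))%:E)%E.
  rewrite ge0_integral_sum//; [|by move=> k; exact: mind|by move=> k x _; rewrite lee_fin].
  rewrite -sumEFin; apply: eq_bigr => k _.
  under eq_integral do rewrite EFinM.
  rewrite ge0_integralZl ?lee_fin//; last by apply/measurable_EFinP; apply: measurable_indic; exact: (mA k).
  rewrite [RHS]EFinM; congr (_ * _)%E; rewrite integral_indic; [|exact: measurableT|exact: (mA k)].
  by rewrite setIT; exact: muA.
have le_int : ((\sum_(k < K) a k * (t / 2 ^+ k / 2))%:E <= dudley_entropy F)%E.
  rewrite -key; apply: ge0_le_integral_set.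
  - by move=> x; apply: sume_ge0 => k _; rewrite lee_fin.
  - by move=> x _; exact: phi_ge0.
  - move=> x _; have [[k xk]|no] := pselect (exists k : 'I_K, A k x); last first.
      rewrite big1 ?phi_ge0// => k _; rewrite indicE memNset ?mulr0// => xk.
      by apply: no; exists k.
    rewrite (bigD1 k)//= indicE mem_set// mulr1 big1 ?adde0.
      by rewrite -phiE; apply: phi_nonincreasing; move: xk; rewrite /A/= in_itv/= => /andP[].
    move=> j jk; rewrite indicE memNset ?mulr0// => xj.
    have mono (p q : nat) : (p < q)%N -> A p x -> A q x -> False.
      move=> pq; rewrite /A/= !in_itv/= => /andP[h1 _] /andP[_ h2].
      have : t / 2 ^+ q <= t / 2 ^+ p.+1.
        by rewrite ler_pM2l// lef_pV2 ?posrE ?exprn_gt0// ler_eXn2l// ltr1n.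
      by move=> h3; move: (lt_le_trans h1 (le_trans h2 h3)); rewrite ltxx.
    move/eqP: jk; apply; apply/val_inj.
    have [jk'|kj|//] := ltngtP j k; exfalso; first exact: (mono _ _ jk' xj xk).
    exact: (mono _ _ kj xk xj).
  - move=> x /= x0; rewrite big1// => k _; rewrite indicE memNset ?mulr0// /A/=.
    rewrite in_itv/= => /andP[h _]; apply: x0; rewrite in_itv/= andbT.
    by apply: lt_trans h; rewrite divr_gt0 ?exprn_gt0.
have fin : dudley_entropy F \is a fin_num.
  rewrite ge0_fin_numE//; apply: integral_ge0 => x _; exact: phi_ge0.
move: le_int; rewrite -(fineK fin) lee_fin -(ler_pM2l (ltr0n R 2)) mulr_sumr.
by apply: le_trans; apply: ler_sum => k _; rewrite /a; lra.
Qed.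

End entropy.

(** * Borel measurability on a compact metric space *)

Section compact_borel.
Context (R : realType) (X : pmetricType R).
Hypothesis hX : compact [set: X].

Lemma compact_continuous_bounded (T : topologicalType) (f : T -> R) :
  compact [set: T] -> continuous f -> exists M, forall x, `|f x| <= M.
Proof.
move=> cT cf; have /compact_bounded [M [_ hM]] : compact (f @` [set: T]).
  by apply: continuous_compact => //; exact: continuous_subspaceT.
by exists (M + 1) => x; apply: hM; [rewrite ltrDl|exists x].
Qed.

Lemma bmeas_continuous (f : X -> R) : continuous f -> bmeas (f : borel X -> R).
Proof.
move=> cf; split; last exact: compact_continuous_bounded.
apply: (measurability _ (RGenOpens.measurableE R)).
move=> _ [_ [a [b ->] <-]]; rewrite setTI; apply: sub_sigma_algebra.
by have /continuousP := cf; apply; exact: interval_open.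
Qed.

Lemma finite_ball_cover (e : R) : 0 < e ->
  exists2 D : set X, finite_set D & forall x, exists2 y, D y & interior (ball y e) x.
Proof.
move=> e0; have := hX; rewrite compact_cover => /(_ X setT (fun y => interior (ball y e))).
case=> [y _|x _|D _ cov]; first exact: open_interior.
  by exists x => //; exact: nbhsx_ballx.
by exists [set x | x \in D] => [|x]; [exact: finite_fset|have [y yD xy] := cov x I; exists y].
Qed.

(* an open set of [X * X] is a countable union of products of small balls
   centered at points of finite nets *)
Lemma open_prod_measurable (U : set (X * X)) : open U ->
  measurable (U : set (borel X * borel X)).
Proof.
move=> oU; have /choice[D hD] : forall k : nat, exists D : set X, finite_set D /\
    forall x, exists2 y, D y & interior (ball y k.+1%:R^-1) x.
  move=> k; have [|D fD hD] := @finite_ball_cover k.+1%:R^-1; first by rewrite invr_gt0.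
  by exists D.
pose B k y : set X := interior (ball y (k.+1%:R^-1 : R)).
have -> : U = \bigcup_k \bigcup_(y in D k) \bigcup_(z in D k)
    [set p | B k y `*` B k z `<=` U /\ (B k y `*` B k z) p].
  apply/seteqP; split=> [[x x'] Uxx'|p [k _ [y _ [z _ [+ ?]]]]]; last exact.
  have : nbhs (x, x') U by apply: open_nbhs_nbhs; split.
  move=> [[V V'] /= [nV nV'] VU].
  have /nbhs_ballP[e /= e0 eV] := nV; have /nbhs_ballP[e' /= e'0 eV'] := nV'.
  pose r := Num.min e e'; have r0 : 0 < r by rewrite lt_min e0 e'0.
  pose k := Num.bound (2 / r).
  have kr : k.+1%:R^-1 + k.+1%:R^-1 <= r.
    rewrite -[X in X + X]mul1r -mulrDl ler_pdivrMr// mulrC -ler_pdivrMr//.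
    rewrite (le_trans (ltW (archi_boundP _)))// ?divr_ge0 ?(ltW r0)//.
    by rewrite ler_nat.
  have [y yD xy] := (hD k).2 x; have [z zD x'z] := (hD k).2 x'.
  exists k => //; exists y => //; exists z => //; split => // -[q q'] /= [qy q'z].
  apply: VU; split => /=.
    apply: eV; apply: le_ball (ball_triangle (ball_sym (interior_subset xy)) (interior_subset qy)).
    by rewrite (le_trans kr)// ge_min lexx.
  apply: eV'; apply: le_ball (ball_triangle (ball_sym (interior_subset x'z)) (interior_subset q'z)).
  by rewrite (le_trans kr)// ge_min lexx orbT.
apply: bigcup_measurable => k _.
apply: fin_bigcup_measurable => [|y _]; first exact: (hD k).1.
apply: fin_bigcup_measurable => [|z _]; first exact: (hD k).1.
have [sub|nsub] := pselect (B k y `*` B k z `<=` U).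
  rewrite (_ : [set p | _] = B k y `*` B k z); last first.
    by apply/seteqP; split => [p []|p].
  by apply: measurableX; apply: sub_sigma_algebra; exact: open_interior.
by rewrite (_ : [set p | _] = set0)//; apply/seteqP; split => [p []|].
Qed.

Lemma bmeas_continuous_prod (c : X * X -> R) : continuous c ->
  bmeas (c : borel X * borel X -> R).
Proof.
move=> cc; split.
  apply: (measurability _ (RGenOpens.measurableE R)).
  move=> _ [_ [a [b ->] <-]]; rewrite setTI; apply: open_prod_measurable.
  by have /continuousP := cc; apply; exact: interval_open.
apply: compact_continuous_bounded => //.
by rewrite -setXTT; apply: compact_setX.
Qed.

End compact_borel.

(** * Integration against the empirical measure *)

Section empirical_integral.
Context d (T : measurableType d) (R : realType) (n : nat) (x : 'I_n -> T).
Hypothesis n0 : (0 < n)%N.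

Lemma empirical_setT : empirical R x setT = 1%E.
Proof.
rewrite /empirical (eq_bigr (fun=> 1%:E)) => [|i _]; last by rewrite diracT.
by rewrite sumEFin sumr_const card_ord -EFinM mulVf// pnatr_eq0 -lt0n.
Qed.

Lemma Rintegral_empirical (f : T -> R) : bmeas f ->
  \int[empirical R x]_z f z = n%:R^-1 * \sum_(i < n) f (x i).
Proof.
move=> bf; have [mf [M hM]] := bf.
(* Finite sums of measures are indexed by [nat]; the default value is never reached below [n]. *)
pose x' k := if insub k is Some i then x i else point.
have x'E (i : 'I_n) : x' i = x i by rewrite /x' valK.
have r0 : 0 <= n%:R^-1 :> R by rewrite invr_ge0.
pose nu := mscale (NngNum r0) (msum (fun k => \d_(x' k) : {measure set T -> \bar R}) n).
have bg : bmeas (fun z => f z + M) by bmeas.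
have g0 z : 0 <= f z + M.
  by have := hM z; rewrite ler_norml => /andP[? _]; lra.
have : \int[empirical R x]_z (f z + M) = n%:R^-1 * \sum_(i < n) (f (x i) + M).
  have mg : measurable_fun setT (fun z => (f z + M)%:E) by apply/measurable_EFinP; case: bg.
  have -> : n%:R^-1 * \sum_(i < n) (f (x i) + M) = fine (\int[nu]_z (f z + M)%:E)%E.
    rewrite /nu ge0_integral_mscale//; last by move=> z _; rewrite lee_fin.
    rewrite ge0_integral_measure_sum//; last by move=> z _; rewrite lee_fin.
    rewrite (eq_bigr (fun i : 'I_n => (f (x i) + M)%:E)) => [|i _].
      by rewrite sumEFin -EFinM.
    by rewrite integral_dirac// diracT mul1e x'E.
  congr fine; apply: eq_measure_integral => A mA _.
  rewrite /nu /mscale /= /msum/= /empirical; congr (_ * _)%E.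
  by apply: eq_bigr => i _; rewrite x'E.
rewrite bRintegralD//; last exact: bmeas_cst.
rewrite Rintegral_cst// big_split/= sumr_const card_ord mulrDr.
rewrite (_ : fine _ = 1); last by have /= -> := empirical_setT.
rewrite mulr1 -[M *+ n]mulr_natl mulrA mulVf ?mul1r; last by rewrite pnatr_eq0 -lt0n.
exact: addIr.
Qed.

End empirical_integral.

(** * Dyadic entropy sums of an interval *)

Section interval_entropy.
Context (R : realType).

(** Each summand is at most [w s - w (s / 2)], and the sum telescopes. For [s <= l],
    [ln (1 + x) <= x] bounds it by [q = Num.sqrt (l * s)], a quarter of [w s], and halving [s]
    multiplies [q] by at most [3/4]. For [s > l] the grid is one point and the summand is 0; the cap
    in [w] makes the bound independent of [t]. *)
Lemma dyadic_interval_entropy_le (l t : R) K : 0 < l -> 0 < t ->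
  \sum_(k < K) t / 2 ^+ k * Num.sqrt (ln (Num.truncn (l / (t / 2 ^+ k))).+1%:R) <= 4 * l.
Proof.
move=> l0 t0; pose w s : R := 4 * Num.min (Num.sqrt (l * s)) l.
have w0 s : 0 <= w s by rewrite mulr_ge0// le_min sqrtr_ge0 ltW.
have step s : 0 < s ->
    s * Num.sqrt (ln (Num.truncn (l / s)).+1%:R) <= w s - w (s / 2).
  move=> s0; have ss : 0 < s / 2 by rewrite divr_gt0.
  have [ls|sl] := ltP l s.
    rewrite (_ : Num.truncn _ = 0%N); last first.
      by apply/truncn0Pn; rewrite -ltNge ltr_pdivrMr// mul1r.
    have mono : Num.sqrt (l * (s / 2)) <= Num.sqrt (l * s).
      by rewrite ler_wsqrtr// ler_pM2l//; lra.
    by rewrite ln1 sqrtr0 mulr0 subr_ge0 ler_pM2l// le_min !ge_min mono lexx orbT.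
  set q := Num.sqrt (l * s).
  have q0 : 0 <= q by exact: sqrtr_ge0.
  have ql : q <= l.
    by rewrite -[leRHS]ger0_norm ?(ltW l0)// -sqrtr_sqr expr2 ler_sqrt ?mulr_ge0 ?(ltW l0)// ler_pM2l.
  have half : Num.sqrt (l * (s / 2)) <= 3 / 4 * q.
    rewrite -[3 / 4]ger0_norm// -sqrtr_sqr -sqrtrM ?sqr_ge0//.
    rewrite ler_sqrt ?mulr_ge0 ?sqr_ge0 ?(ltW l0) ?(ltW s0)//.
    have := mulr_gt0 l0 s0; rewrite mulrA expr2; lra.
  have lhs : s * Num.sqrt (ln (Num.truncn (l / s)).+1%:R) <= q.
    rewrite -[s in s * _]ger0_norm ?(ltW s0)// -sqrtr_sqr -sqrtrM ?sqr_ge0//.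
    rewrite ler_sqrt ?mulr_ge0 ?(ltW l0) ?(ltW s0)// expr2 -mulrA [l * s]mulrC ler_pM2l//.
    rewrite mulrC -ler_pdivlMr// -natr1 addrC.
    have tr0 : 0 <= (Num.truncn (l / s))%:R :> R by [].
    apply: (le_trans (le_ln1Dx _)); first by rewrite (lt_le_trans _ tr0)// ltrN10.
    by rewrite truncn_le divr_ge0 ?ltW.
  rewrite /w (min_idPl ql).
  have : Num.min (Num.sqrt (l * (s / 2))) l <= 3 / 4 * q by rewrite ge_min half.
  lra.
have tele : \sum_(k < K) t / 2 ^+ k * Num.sqrt (ln (Num.truncn (l / (t / 2 ^+ k))).+1%:R) <=
    w t - w (t / 2 ^+ K).
  elim: K => [|K ih]; first by rewrite big_ord0 expr0 divr1 subrr.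
  have tK : 0 < t / 2 ^+ K by rewrite divr_gt0 ?exprn_gt0.
  have := step _ tK; rewrite big_ord_recr/= (_ : t / 2 ^+ K / 2 = t / 2 ^+ K.+1); last first.
    by rewrite exprSr invfM mulrA.
  by move: ih; lra.
apply: (le_trans tele); rewrite lerBlDr (@le_trans _ _ (4 * l))// ?lerDl// ?w0//.
by rewrite /w ler_pM2l// ge_min lexx orbT.
Qed.

End interval_entropy.

(** * Uniform concentration of the dual generator *)

Section supnorm_bounds.
Context (R : realType) (X : pmetricType R).
Implicit Types (F : set (X -> R)) (f g : X -> R).

Lemma le_supnorm f (M : R) x : (forall z, `|f z| <= M) -> `|f x| <= supnorm f.
Proof. by move=> fM; apply: ub_le_sup; [exists M => _ [z _ <-]|exists x]. Qed.

Lemma supnorm_le f (r : R) : (forall x, `|f x| <= r) -> supnorm f <= r.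
Proof. by move=> fr; apply: ge_sup; [exists `|f point|, point|move=> _ [x _ <-]]. Qed.

Hypothesis hX : compact [set: X].

Lemma continuous_le_supnorm f x : continuous f -> `|f x| <= supnorm f.
Proof.
move=> cf; have [M hM] := compact_continuous_bounded hX cf.
exact: le_supnorm hM.
Qed.

Lemma continuousB_le_supnorm f g x : continuous f -> continuous g ->
  `|f x - g x| <= supnorm (fun z => f z - g z).
Proof.
move=> cf cg; have [M hM] := compact_continuous_bounded hX cf.
have [N hN] := compact_continuous_bounded hX cg.
apply: (@le_supnorm (fun z => f z - g z) (M + N)) => z.
by rewrite (le_trans (ler_normB _ _))// lerD.
Qed.

(** [class_norm] is a supremum in [R], meaningful only once bounded: every member of [F] lies within
    1 of one of finitely many bounded functions. *)
Lemma le_class_norm F f x : (forall g, F g -> continuous g) ->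
  packing_number F 1 \is a fin_num -> F f -> `|f x| <= class_norm F.
Proof.
move=> cF /maximal_packing[n [g [_ Fg net]]] Ff.
apply: (le_trans (continuous_le_supnorm x (cF _ Ff))).
apply: ub_le_sup; last by exists f.
exists (1 + \sum_(i < n) supnorm (g i)) => _ [h Fh <-].
apply: supnorm_le => z; have [i hi] := net h Fh.
rewrite -[h z](subrK (g i z)) (le_trans (ler_normD _ _))// lerD//.
  apply: (le_trans _ (ltW hi)); apply: continuousB_le_supnorm; exact: cF.
apply: (le_trans (continuous_le_supnorm z (cF _ (Fg i)))).
rewrite (bigD1 i)//= lerDl; apply: sumr_ge0 => j _.
exact: le_trans (normr_ge0 _) (continuous_le_supnorm point (cF _ (Fg j))).
Qed.

End supnorm_bounds.

Section uniform_concentration.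
Context (R : realType) (X : pmetricType R).
Variables (c : X * X -> R) (F : set (X -> R)) (f0 : X -> R).
Variables (pi0 : R.-pker borel X ~> borel X) (eps tau : R).
Hypothesis hX : compact [set: X].
Hypothesis bc : bmeas (c : borel X * borel X -> R).
Hypothesis c0 : forall x y, 0 <= c (x, y).
Hypotheses (heps : 0 < eps) (htau : 0 <= tau).
Hypothesis hF : forall f, F f -> continuous f.
Hypothesis Ff0 : F f0.
Hypothesis hdudley : (dudley_entropy F < +oo)%E.
Variable m : R.
Hypothesis cm : forall x, \int[pi0 x]_z c (x, z) <= m.
Hypothesis m0 : 0 <= m.

Context d (Omega : measurableType d) (Pr : probability Omega R).
Variables (P : probability (borel X) R) (n : nat) (xi : 'I_n -> {RV Pr >-> borel X}).
Hypothesis hxi : iid_from xi P.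
Hypothesis n0 : (0 < n)%N.
Variables (tmin l delta : R).
Hypotheses (tmin0 : 0 < tmin) (tl : tmin <= l).
Hypothesis delta01 : 0 < delta < 1.

Local Notation M := (class_norm F).
Hypothesis M0 : 0 < M.

Local Notation third := (m * eps / (eps * tmin + tau)).
Local Notation Phi := (rescaled_generator c pi0 eps tau).
Local Notation A := (M + l + third).

Let fM f x : F f -> `|f x| <= M.
Proof.
by move=> Ff; apply: le_class_norm => //; exact: packing_number_fin Ff0 hdudley _ ltr01.
Qed.

Let bF f : F f -> bmeas (f : borel X -> R).
Proof. by move=> /hF; exact: bmeas_continuous. Qed.

Let b : R := 2 * M * l + m.
Let l0 : 0 < l. Proof. exact: lt_le_trans tl. Qed.
Let b0 : 0 < b. Proof. by rewrite ltr_wpDr// !mulr_gt0. Qed.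
Let third0 : 0 <= third.
Proof. by rewrite divr_ge0 ?addr_ge0 ?mulr_ge0 ?(ltW heps) ?(ltW tmin0). Qed.
Let A0 : 0 < A. Proof. by rewrite ltr_wpDr// addr_gt0. Qed.

(** Moving both [f] and [theta] by at most [t k] changes [Phi] by at most [A * t k], so the net for
    [Phi] has scale [b / 12] at the base, a twelfth of the range [b]. *)
Let t k : R := (b / 12 / A) / 2 ^+ k.
Let t0 k : 0 < t k. Proof. by rewrite !divr_gt0 ?exprn_gt0. Qed.

Let tA k : A * t k = b / 12 / 2 ^+ k.
Proof. by rewrite /t [_ / A / _]mulrAC mulrC divfK// gt_eqF. Qed.

Let C : set (R * (X -> R)) := [set p | (tmin <= p.1 <= l) /\ F p.2].

Let NF_g k := cid (maximal_packing (packing_number_fin Ff0 hdudley (t0 k))).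
Let NF k : nat := sval (NF_g k).
Let g k : 'I_(NF k) -> X -> R := sval (cid (svalP (NF_g k))).
Let gP k : [/\ packing_number F (t k) = (NF k)%:R%:E, forall i : 'I_(NF k), F (g i) &
  forall f, F f -> exists i : 'I_(NF k), supnorm (fun x => f x - g i x) < t k].
Proof. exact: (svalP (cid (svalP (NF_g k)))). Qed.

Let Nt k : nat := (Num.truncn (l / t k)).+1.
(** The minimum keeps every grid point in the admissible interval; it is inactive at the points used
    to approximate some [theta]. *)
Let grid k (j : 'I_(Nt k)) : R := Num.min (tmin + j%:R * t k) l.

Let N k : nat := #|{: 'I_(NF k) * 'I_(Nt k)}|.
Let pt k (j : 'I_(N k)) : R * (X -> R) := (grid (enum_val j).2, g (enum_val j).1).

Let pt_in k (j : 'I_(N k)) : C (pt j).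
Proof.
split; last by have [_ Fg _] := gP k; exact: Fg.
by rewrite /= /grid le_min tl ge_min lexx orbT !andbT lerDl mulr_ge0// ltW.
Qed.

Let net k p : C p -> exists j : 'I_(N k), forall x,
  `|Phi p.1 p.2 x - Phi (pt j).1 (pt j).2 x| <= b / 12 / 2 ^+ k.
Proof.
case: p => theta f [/= /andP[tt tl'] Ff].
have [_ Fg netF] := gP k; have [i hi] := netF f Ff.
have tt0 : 0 <= theta - tmin by rewrite subr_ge0.
have jN : (Num.truncn ((theta - tmin) / t k) < Nt k)%N.
  by rewrite ltnS le_truncn// ler_pM2r ?invr_gt0// lerBlDr (le_trans tl')// lerDl ltW.
pose j := Ordinal jN.
have /andP[j1 j2] : (Num.truncn ((theta - tmin) / t k))%:R <= (theta - tmin) / t k <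
    (Num.truncn ((theta - tmin) / t k)).+1%:R by apply: truncn_itv; rewrite divr_ge0// ltW.
move: j1 j2; rewrite ler_pdivlMr// ltr_pdivrMr// => j1 j2.
have gridE : grid j = tmin + j%:R * t k.
  by rewrite /grid; apply/min_idPl; move: j1 => /=; lra.
exists (enum_rank (i, j)) => x; rewrite /pt enum_rankK/=.
have theta0 : 0 < theta by exact: lt_le_trans tt.
have h1 : `|Phi theta f x - Phi theta (g i) x| <= theta * t k.
  apply: rescaled_generator_lipschitz_f => //; [exact: bF|exact/bF/Fg|].
  move=> z; apply: le_trans (ltW hi); apply: continuousB_le_supnorm => //; exact: hF.
have gt : tmin <= grid j by rewrite gridE lerDl mulr_ge0// ltW.
have h2 : `|Phi theta (g i) x - Phi (grid j) (g i) x| <= (M + third) * t k.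
  apply: (le_trans (rescaled_generator_lipschitz_theta bc c0 heps htau cm x tmin0 tt gt
    (bF (Fg i)) (fun z => fM z (Fg i)))).
  rewrite ler_wpM2l ?addr_ge0 ?(ltW M0)// gridE ger0_norm; last by move: j1 => /=; lra.
  by move: j2; rewrite -natr1 /=; lra.
rewrite -tA -(subrKA (Phi theta (g i) x)) (le_trans (ler_normD _ _))//.
apply: (le_trans (lerD h1 h2)).
have h3 : theta * t k <= l * t k by rewrite ler_pM2r.
by move: h3; rewrite !mulrDl; lra.
Qed.

Let range p : C p -> exists a, forall x, a <= Phi p.1 p.2 x <= a + 12 * (b / 12).
Proof.
case: p => theta f [/= /andP[tt tl'] Ff]; have theta0 : 0 < theta by exact: lt_le_trans tt.
exists (- (theta * M) - m) => x.
have bnd z : - M <= f z <= M by rewrite -ler_norml fM.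
rewrite rescaled_generator_ge//; [|exact: bF|by move=> z; have /andP[] := bnd z].
rewrite /=; apply: (@le_trans _ _ (theta * M)).
  apply: rescaled_generator_le => //; first exact: bF.
  by move=> z; have /andP[] := bnd z.
have : theta * M <= l * M by rewrite ler_pM2r.
rewrite /b; lra.
Qed.

Lemma uniform_concentration : exists2 E : set Omega,
  measurable E /\ ((1 - delta)%:E <= Pr E)%E &
  forall w, E w -> forall theta f, tmin <= theta <= l -> F f ->
  centered_mean P xi (Phi theta f) w <=
    (48 * A * (fine (dudley_entropy F) + 2 * l) + b * Num.sqrt (2 * ln (2 / delta))) /
    Num.sqrt n%:R.
Proof.
set U := 48 * _ * _ + _.
have bPhi p : C p -> bmeas (Phi p.1 p.2 : borel X -> R).
  by move=> [_ Fp]; apply: bmeas_rescaled_generator => //; exact: bF.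
have e00 : 0 < b / 12 by rewrite divr_gt0.
have NF0 k : (0 < NF k)%N.
  have [pE _ _] := gP k; have := packing_number_ge1 (t k) Ff0.
  by rewrite pE lee_fin ler1n.
have U_ge K : 6 * Num.sqrt 2 *
    (\sum_(k < K) b / 12 / 2 ^+ k * Num.sqrt (ln (N k)%:R)) +
    12 * (b / 12) * Num.sqrt (2 * ln (2 / delta)) <= U.
  rewrite (_ : 12 * (b / 12) = b); last by lra.
  rewrite lerD2r.
  have sumF : \sum_(k < K) t k * Num.sqrt (ln (NF k)%:R) <= 2 * fine (dudley_entropy F).
    apply: (dyadic_entropy_le Ff0 hdudley); first by rewrite !divr_gt0.
    by move=> k; have [pE _ _] := gP k.
  have sumT : \sum_(k < K) t k * Num.sqrt (ln (Nt k)%:R) <= 4 * l.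
    by apply: dyadic_interval_entropy_le => //; rewrite !divr_gt0.
  have sumN : \sum_(k < K) b / 12 / 2 ^+ k * Num.sqrt (ln (N k)%:R) <=
      A * (2 * fine (dudley_entropy F) + 4 * l).
    apply: (@le_trans _ _ (A * (\sum_(k < K) t k * Num.sqrt (ln (NF k)%:R) +
        \sum_(k < K) t k * Num.sqrt (ln (Nt k)%:R)))); last first.
      by rewrite ler_pM2l// lerD.
    rewrite -big_split/= mulr_sumr; apply: ler_sum => k _.
    rewrite -mulrDr mulrA tA.
    rewrite ler_wpM2l ?divr_ge0 ?exprn_ge0 ?(ltW b0)//.
    (* The net is a product, so the logarithms add, and the square root is subadditive. *)
    rewrite /N card_prod !card_ord natrM lnM ?posrE ?ltr0n//.
    have a0 : 0 <= ln (NF k)%:R :> R by rewrite ln_ge0// ler1n.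
    have b0' : 0 <= ln (Nt k)%:R :> R by rewrite ln_ge0// ler1n.
    rewrite -ler_sqr ?nnegrE ?addr_ge0 ?sqrtr_ge0//.
    rewrite sqrrD !sqr_sqrtr ?addr_ge0// lerD2r lerDl.
    by rewrite mulrn_wge0// mulr_ge0 ?sqrtr_ge0.
  have s4 : 6 * Num.sqrt 2 <= 24 :> R.
    have : Num.sqrt 2 <= 2 :> R.
      by rewrite -[leRHS]ger0_norm// -sqrtr_sqr ler_wsqrtr// expr2; lra.
    lra.
  have I0 : 0 <= fine (dudley_entropy F).
    by rewrite fine_ge0//; apply: integral_ge0 => x _; exact: sqrte_ge0.
  apply: (@le_trans _ _ (6 * Num.sqrt 2 * (A * (2 * fine (dudley_entropy F) + 4 * l)))).
    by rewrite ler_wpM2l ?mulr_ge0 ?sqrtr_ge0.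
  apply: (@le_trans _ _ (24 * (A * (2 * fine (dudley_entropy F) + 4 * l)))); last first.
    rewrite le_eqVlt; apply/orP; left; apply/eqP.
    by set a := A; set J := fine _; rewrite -/a; ring.
  by rewrite ler_wpM2r// mulr_ge0 ?(ltW A0)// addr_ge0 ?mulr_ge0 ?(ltW l0).
have [E mE hE] := chaining hxi n0 (h := fun p => Phi p.1 p.2 : borel X -> R) bPhi
  pt_in net e00 range delta01 U_ge.
by exists E => // w Ew theta f ht Ff; exact: (hE w Ew (theta, f) (conj ht Ff)).
Qed.

End uniform_concentration.

(** * From uniform concentration to the robust risks *)

Unset Implicit Arguments.

Theorem proposition3p3 (R : realType) (X : pmetricType R)
  (c : X * X -> R) (F : set (X -> R))
  (hX : compact [set: X])
  (hc_cont : continuous c)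
  (hc_ge0 : forall x y, 0 <= c (x, y))
  (hc_eq0 : forall x y, c (x, y) = 0 <-> x = y)
  (hF_cont : forall f, F f -> continuous f)
  (hF_compact : compact (F : set {uniform X -> R}))
  (hF_dudley : (dudley_entropy F < +oo)%E)
  (P : probability (borel X) R)
  (pi0 : R.-pker borel X ~> borel X)
  (eps tau : R) (heps : 0 < eps) (htau : 0 <= tau)
  (hcrit : 4 * cond_moment c pi0 < crit_radius c pi0 eps tau P F)
  (lambda_low : R) (hlow : 0 < lambda_low)
  (hmax : forall lambda, 0 <= lambda <= 2 * lambda_low ->
    crit_radius c pi0 eps tau P F / 4 <= max_radius c pi0 eps tau P F lambda)
  (delta rho : R) (hdelta : 0 < delta < 1) (hrho : cond_moment c pi0 < rho)
  (d : measure_display) (Omega : measurableType d) (Pr : probability Omega R)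
  (n : nat) (xi : 'I_n -> {RV Pr >-> borel X}) (hxi : iid_from xi P)
  (hn : 16 * alpha c pi0 eps tau F lambda_low rho delta ^+ 2
          / (crit_radius c pi0 eps tau P F - 4 * cond_moment c pi0) ^+ 2
        < n%:R)
  (hrho_le : rho <= crit_radius c pi0 eps tau P F / 4
               - alpha c pi0 eps tau F lambda_low rho delta / Num.sqrt n%:R) :
  exists2 E : set Omega,
    measurable E /\ ((1 - delta)%:E <= Pr E)%E &
    forall omega, E omega -> forall f, F f ->
      (robust_risk c pi0 eps tau rho (empirical R (fun i => xi i omega)) f
       <= robust_risk c pi0 eps tau
            (rho + alpha c pi0 eps tau F lambda_low rho delta / Num.sqrt n%:R)
            P f)%E.
Proof.
have /andP[d0 d1] := hdelta.
have bc : bmeas (c : borel X * borel X -> R) by exact: bmeas_continuous_prod.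
set m := cond_moment c pi0 in hcrit hrho *.
have [_ [Cc hCc]] := bc.
have cm (x : borel X) : \int[pi0 x]_z c (x, z) <= m.
  apply: ub_le_sup; last by exists x.
  exists Cc => _ [y _ <-].
  apply: le_trans (ler_norm _) _.
  by apply: (bRintegral_norm_le (kernel_prob pi0 y)) => //; exact: (@bmeas_pair _ _ (borel X) (borel X) R c y bc).
have m0 : 0 <= m.
  by apply: le_trans (cm point); apply: Rintegral_ge0.
(* The infimum of the empty set is 0 by convention, which would contradict a critical radius above
   [4 * m >= 0]. *)
have [f0 Ff0] : exists f0, F f0.
  apply: contrapT => /forallNP F0; move: hcrit.
  rewrite /crit_radius (_ : F = set0); last by apply/seteqP; split => // f /F0.
  by rewrite image_set0 inf0 ltNge mulr_ge0.
set rc := crit_radius _ _ _ _ _ _ in hcrit hmax hn hrho_le.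
set M := class_norm F.
have fM f x : F f -> `|f x| <= M.
  by move=> Ff; apply: le_class_norm => //; exact: packing_number_fin Ff0 hF_dudley _ ltr01.
have M_ge0 : 0 <= M := le_trans (normr_ge0 _) (fM f0 point Ff0).
have bF f : F f -> bmeas (f : borel X -> R) by move=> /hF_cont; exact: bmeas_continuous.
have n0 : (0 < n)%N.
  rewrite -(ltr0n R); apply: le_lt_trans hn.
  apply: divr_ge0; last exact: sqr_ge0.
  by apply: mulr_ge0; [exact: ler0n|exact: sqr_ge0].
set al := alpha _ _ _ _ _ _ _ _ in hn hrho_le *.
have I0 : 0 <= fine (dudley_entropy F).
  by rewrite fine_ge0//; apply: integral_ge0 => x _; exact: sqrte_ge0.
have rm0 : 0 < rho - m by rewrite subr_gt0.
have al0 : 0 <= al.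
  have li0 : 0 <= lambda_low^-1 by rewrite invr_ge0 ltW.
  have den0 : 0 <= eps * (rho - m) + 2 * tau * M.
    by rewrite addr_ge0 ?mulr_ge0 ?(ltW heps) ?(ltW rm0).
  have num0 : 0 <= 2 * M * m * eps by rewrite !mulr_ge0// ltW.
  rewrite /al /alpha -/m -/M; apply: addr_ge0; apply: mulr_ge0.
  - by rewrite mulr_ge0 ?addr_ge0 ?divr_ge0.
  - by rewrite addr_ge0 ?mulr_ge0.
  - by rewrite addr_ge0 ?mulr_ge0.
  - exact: sqrtr_ge0.
set rho' := rho + al / Num.sqrt n%:R.
have rho_le : rho <= rho' by rewrite lerDl divr_ge0.
have rm0' : 0 < rho' - m by rewrite subr_gt0 (lt_le_trans hrho).
have rho'_le : rho' <= rc / 4 by move: hrho_le; rewrite -lerBrDr.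
have l20 : 0 < 2 * lambda_low by rewrite mulr_gt0.
(* The assumption on the maximal radius is used at the right end [2 * lambda_low] of its window, a
   positive point where [dual_slope] is minus the derivative. *)
have opt f : F f -> exists lam, [/\ 2 * lambda_low <= lam, lam <= 2 * M / (rho' - m) &
    \int[P]_x dual_slope c pi0 eps tau lam f x = rho'].
  move=> Ff; apply: (exists_dual_optimum bc heps htau (bF f Ff) (fun x => fM f x Ff) cm) => //.
    by rewrite -subr_gt0.
  apply: (le_trans rho'_le).
  have /hmax/le_trans : 0 <= 2 * lambda_low <= 2 * lambda_low by rewrite ltW/=.
  apply; apply: ge_inf; last first.
    exists f => //; apply: eq_Rintegral => x _.
    rewrite (derive1_dual_generator pi0 bc heps htau (bF f Ff) (fun x => fM f x Ff))//.
    by rewrite opprK.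
  (* An infimum in [R] is a lower bound only of a set bounded below; here 0 bounds it, as the slopes
     are nonnegative. *)
  exists 0 => _ [h Fh <-]; apply: Rintegral_ge0 => x _.
  rewrite (derive1_dual_generator pi0 bc heps htau (bF h Fh) (fun x => fM h x Fh))//.
  by rewrite opprK; apply: dual_slope_ge0 => //; exact: bF.
(* Otherwise no positive [lam] could lie below [2 * M / (rho' - m)]. *)
have M0 : 0 < M.
  have [lam [h1 h2 _]] := opt f0 Ff0.
  have : 0 < 2 * M / (rho' - m) by rewrite (lt_le_trans l20)// (le_trans h1).
  by rewrite pmulr_lgt0 ?invr_gt0// pmulr_rgt0.
(* Both ends are looser than [opt] provides, [rho] for [rho'] and [lambda_low] for [2 * lambda_low],
   to match the terms of [alpha]. *)
pose tmin := (rho - m) / (2 * M).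
pose l := lambda_low^-1.
have tmin0 : 0 < tmin by rewrite divr_gt0 ?mulr_gt0.
have lam_inv lam : 2 * lambda_low <= lam -> lam <= 2 * M / (rho' - m) ->
    tmin <= lam^-1 <= l.
  move=> h1 h2; have lam0 : 0 < lam by exact: lt_le_trans h1.
  apply/andP; split.
    rewrite -[leLHS]invrK lef_pV2 ?posrE ?invr_gt0// invf_div (le_trans h2)//.
    by rewrite ler_wpM2l ?mulr_ge0// lef_pV2 ?posrE// lerD2r.
  by rewrite lef_pV2 ?posrE// (le_trans _ h1)// ler_peMl ?ler1n ?(ltW hlow).
have tl : tmin <= l.
  have [lam [h1 h2 _]] := opt f0 Ff0.
  by have /andP[] := lam_inv lam h1 h2; exact: le_trans.
have [E [mE PE] hE] := uniform_concentration hX bc hc_ge0 heps htau hF_cont Ff0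
  hF_dudley cm m0 hxi n0 tmin0 tl hdelta M0.
exists E; first exact: (conj mE PE).
move=> w Ew f Ff.
have [lam [h1 h2 Geq]] := opt f Ff.
have lam0 : 0 < lam by exact: lt_le_trans h1.
have alE : 48 * (M + l + m * eps / (eps * tmin + tau)) * (fine (dudley_entropy F) + 2 * l) +
    (2 * M * l + m) * Num.sqrt (2 * ln (2 / delta)) = al.
  rewrite /al /alpha -/m -/M /l; congr (48 * (_ + _) * _ + _ * _).
  have -> : eps * tmin + tau = (eps * (rho - m) + 2 * tau * M) / (2 * M).
    by rewrite /tmin; field; rewrite gt_eqF.
  by rewrite invf_div mulrA; congr (_ / _); ring.
have := hE w Ew lam^-1 f (lam_inv lam h1 h2) Ff.
rewrite alE => conc.
set Q := empirical R _.
have Q1 : Q setT = 1%E by exact: empirical_setT.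
have RL := robust_risk_le pi0 bc heps htau rho Q1 (ltW lam0) (bF f Ff).
apply: (le_trans RL).
apply: (le_trans _ (robust_risk_ge bc heps htau (ltW lam0) (bF f Ff) Geq)).
have bPhi := bmeas_rescaled_generator pi0 eps tau bc lam^-1 (bF f Ff).
have phiE x := dual_generator_rescaled c pi0 heps htau f x lam0.
rewrite lee_fin.
have -> : \int[Q]_x dual_generator c pi0 eps tau lam f x =
    lam * \int[Q]_x rescaled_generator c pi0 eps tau lam^-1 f x.
  by rewrite -bRintegralZl//; apply: eq_Rintegral => x _; exact: phiE.
have -> : \int[P]_x dual_generator c pi0 eps tau lam f x =
    lam * \int[P]_x rescaled_generator c pi0 eps tau lam^-1 f x.
  by rewrite -bRintegralZl//; apply: eq_Rintegral => x _; exact: phiE.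
(* The common factor [lam] and the radius [rho] cancel; what remains is the concentration bound. *)
rewrite -!mulrDr ler_pM2l// /Q Rintegral_empirical// /rho' -addrA lerD2l.
by rewrite -lerBlDr.
Qed.
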